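(* Let $\lambda>\frac{n-1}{2}$, $1<s<\infty$, $0<p<s$, $n\left(\frac{p}{s}-1\right)<\alpha<n(p-1)$ and $\alpha\le0$. Then the maximal Bochner-Riesz operator $B_*^\lambda$ is of type $(BL^{p,s}_{|x|^\alpha},L^p_{|x|^\alpha})$ on $\mathbf{R}^n$; that is, there is a constant $C$ such that $\|B_*^\lambda f\|_{L^p_{|x|^\alpha}}\le C\|f\|_{BL^{p,s}_{|x|^\alpha}}$ for all $f\in BL^{p,s}_{|x|^\alpha}$.
   Context: Bochner-Riesz means: for $\lambda\ge0$ and $0<R<\infty$, $(B_R^\lambda f)^\wedge(\xi)=(1-|\xi/R|^2)^\lambda_+\hat f(\xi)$, i.e. $B_R^\lambda f=f*K_R^\lambda$, where $K_R^\lambda$ is the inverse Fourier transform of $(1-|\xi/R|^2)_+^\lambda$ on $\mathbf{R}^n$; the maximal operator is $B_*^\lambda f(x)=\sup_{R>0}|B_R^\lambda f(x)|$. Also $\|g\|_{L^p_{|x|^\alpha}}=\left(\int_{\mathbf{R}^n}|g(x)|^p|x|^\alpha dx\right)^{1/p}$. Blocks: for $\alpha\in\mathbf{R}$, $0<p<\infty$, $0<s\le\infty$, a function $a$ on $\mathbf{R}^n$ is a $(p,s,\alpha)$-block if there is a ball $B(x_0,r)=\{x:|x-x_0|\le r\}$ with $x_0\in\mathbf{R}^n$, $r>0$, such that $\operatorname{supp}a\subseteq B(x_0,r)$ and $\|a\|_{L^s}\le|B(x_0,r)|^{-\frac{\alpha}{pn}-\frac1p+\frac1s}$ ($|\cdot|$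 is Lebesgue measure). Let $\bar p=\min\{p,1\}$. The space $BL^{p,s}_{|x|^\alpha}$ consists of all $f=\sum_{k}\lambda_ka_k$ (countable sum, convergence a.e.), where each $a_k$ is a $(p,s,\alpha)$-block and $\sum_k|\lambda_k|^{\bar p}<\infty$, with quasinorm $\|f\|_{BL^{p,s}_{|x|^\alpha}}=\inf\left(\sum_k|\lambda_k|^{\bar p}\right)^{1/\bar p}$, the infimum over all such decompositions. *)

(* Defs.v *)
From HB Require Import structures.
From mathcomp Require Import all_boot all_order all_algebra.
From mathcomp Require Import all_classical all_reals all_analysis.
From mathcomp.real_closed Require Import complex.

Set Implicit Arguments.
Unset Strict Implicit.
Unset Printing Implicit Defensive.

Import Order.TTheory GRing.Theory Num.Theory.
Import numFieldNormedType.Exports.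
Import ComplexField.Normc.

Local Open Scope classical_set_scope.
Local Open Scope ring_scope.
Local Open Scope complex_scope.

(* R^n is the type [n.-tuple R], with the library's product sigma-algebra, and
   its Lebesgue measure [lebesgueN n] is the n-fold product of
   [lebesgue_measure], built by adding one coordinate at a time. *)
Section lebesgueN.
Context {R : realType}.

Definition add_coord (n : nat) (u : n.-tuple R * R) : n.+1.-tuple R :=
  [tuple of u.2 :: u.1].

Lemma measurable_add_coord (n : nat) :
  measurable_fun [set: n.-tuple R * R] (@add_coord n).
Proof. exact: measurable_cons. Qed.

Section prod_lebesgue.
Context {n : nat} (m : {measure set (n.-tuple R) -> \bar R}).

Definition prod_lebesgue : set (n.+1.-tuple R) -> \bar R :=
  pushforward (m \x @lebesgue_measure R)%E (@add_coord n).

Let prod_lebesgue0 : prod_lebesgue set0 = 0%E.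
Proof. by rewrite /prod_lebesgue /pushforward preimage_set0 measure0. Qed.

Let prod_lebesgue_ge0 A : (0 <= prod_lebesgue A)%E.
Proof. by rewrite /prod_lebesgue /pushforward; exact: measure_ge0. Qed.

Let prod_lebesgue_sigma_additive : semi_sigma_additive prod_lebesgue.
Proof.
have mf := @measurable_add_coord n.
exact: (@measure_semi_sigma_additive _ _ _
  (measure_function_pushforward__canonical__measure_function_Measure
     (m \x @lebesgue_measure R)%E mf)).
Qed.

HB.instance Definition _ := isMeasure.Build _ _ _ prod_lebesgue
  prod_lebesgue0 prod_lebesgue_ge0 prod_lebesgue_sigma_additive.

End prod_lebesgue.

Fixpoint lebesgueN (n : nat) : {measure set (n.-tuple R) -> \bar R} :=
  match n with
  | 0 => \d_([tuple])
  | m.+1 => prod_lebesgue (lebesgueN m)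
  end.

Lemma lebesgueN_box (n : nat) (A : 'I_n -> set R) :
  (forall i, measurable (A i)) ->
  lebesgueN n [set x | forall i, A i (tnth x i)] =
  (\prod_(i < n) @lebesgue_measure R (A i))%E.
Proof.
elim: n A => [|n IHn] A mA.
  by rewrite big_ord0 /= diracE mem_set //= => -[].
rewrite big_ord_recl /= /prod_lebesgue /pushforward.
rewrite [X in product_measure1 _ _ X](_ : _ =
    [set x | forall i, A (lift ord0 i) (tnth x i)] `*` A ord0); last first.
  apply/seteqP; split => -[x t] /=.
    move=> H; split; last exact: (H ord0).
    by move=> i; have := H (lift ord0 i); rewrite tnthS.
  move=> [Hx Ht] i; case: (unliftP ord0 i) => [j ->|-> //].
  by rewrite tnthS.
have mB : measurable [set x : n.-tuple R |
    forall i, A (lift ord0 i) (tnth x i)].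
  rewrite (_ : [set x | _] = \bigcap_(i in [set: 'I_n])
     ((fun x : n.-tuple R => tnth x i) @^-1` A (lift ord0 i))).
    apply: fin_bigcap_measurable => // i _.
    by rewrite -[X in measurable X]setTI; exact: measurable_tnth.
  by apply/seteqP; split => x /= H i; [move=> _|]; exact: H.
rewrite product_measure1E //; last exact: mA.
rewrite [LHS]muleC; congr (_ * _)%E.
by apply: (IHn (fun i => A (lift ord0 i))) => i; exact: mA.
Qed.

End lebesgueN.

Section euclidean.
Context {R : realType} {n : nat}.
Implicit Types x y : n.-tuple R.

Definition sub_tuple x y : n.-tuple R :=
  [tuple tnth x i - tnth y i | i < n].

Definition dot_tuple x y : R := \sum_(i < n) tnth x i * tnth y i.

Definition enorm x : R := Num.sqrt (\sum_(i < n) tnth x i ^+ 2).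

Definition eball (x0 : n.-tuple R) (r : R) : set (n.-tuple R) :=
  [set x | enorm (sub_tuple x x0) <= r].

(* The closure of [{x | a x != 0}] for the Euclidean distance. *)
Definition supp (a : n.-tuple R -> R[i]) : set (n.-tuple R) :=
  [set x | forall e : R, 0 < e ->
     exists2 y, a y != 0 & enorm (sub_tuple y x) < e].

End euclidean.

Section bochner_riesz.
Context {R : realType} {n : nat}.
Implicit Types (f m : n.-tuple R -> R[i]) (x xi : n.-tuple R).
Local Notation mu := (@lebesgueN R n).

Definition cintegral f : R[i] :=
  (\int[mu]_x complex.Re (f x)) +i* (\int[mu]_x complex.Im (f x)).

(* Normalization: fhat(xi) = \int f(x) exp(-2 i pi x.xi) dx. With the other
   common normalization, exp(-i x.xi) and (2 pi)^-n in the inverse, the kernel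
   of index L becomes the one below of index L / (2 pi), so that the maximal
   operator, a supremum over all L > 0, is the same. *)
Definition inv_fourier m : n.-tuple R -> R[i] := fun x =>
  cintegral (fun xi =>
    let t := 2 * pi * dot_tuple x xi in (cos t +i* sin t) * m xi).

Definition convolution f g : n.-tuple R -> R[i] := fun x =>
  cintegral (fun y => f y * g (sub_tuple x y)).

(* (1 - |xi/L|^2)_+^lambda; the case distinction makes it vanish outside the
   ball also for lambda = 0, where [0 `^ 0 = 1]. *)
Definition br_multiplier (lambda L : R) xi : R :=
  if enorm xi < L then (1 - (enorm xi / L) ^+ 2) `^ lambda else 0.

Definition br_kernel (lambda L : R) : n.-tuple R -> R[i] :=
  inv_fourier (fun xi => (br_multiplier lambda L xi)%:C).

Definition bochner_riesz (lambda L : R) f : n.-tuple R -> R[i] :=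
  convolution f (br_kernel lambda L).

Definition max_bochner_riesz (lambda : R) f : n.-tuple R -> \bar R := fun x =>
  ereal_sup [set (normc (bochner_riesz lambda L f x))%:E
            | L in [set L : R | 0 < L]].

End bochner_riesz.

Section block_spaces.
Context {R : realType} {n : nat}.
Implicit Types (a f : n.-tuple R -> R[i]).
Local Notation mu := (@lebesgueN R n).

(* The L^p norm with respect to |x|^alpha dx. *)
Definition wLnorm (p alpha : R) (g : n.-tuple R -> \bar R) : \bar R :=
  ((\int[mu]_x (`|g x| `^ p * (enorm x `^ alpha)%:E)) `^ p^-1)%E.

(* 1/s, with 1/oo = 0, is [fine s^-1]. *)
Definition is_block (p : R) (s : \bar R) (alpha : R) a : Prop :=
  [/\ measurable_fun [set: n.-tuple R] (fun x => complex.Re (a x)),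
      measurable_fun [set: n.-tuple R] (fun x => complex.Im (a x)) &
      exists (x0 : n.-tuple R) (r : R),
        [/\ 0 < r, supp a `<=` eball x0 r &
            (Lnorm mu s (fun x => (normc (a x))%:E) <=
             mu (eball x0 r) `^
               (- (alpha / (p * n%:R)) - p^-1 + fine s^-1)%R)%E]].

Definition pbar (p : R) : R := Num.min p 1.

Definition coeff_sum_pbar (p : R) (c : nat -> R[i]) : \bar R :=
  (\sum_(0 <= k <oo) (normc (c k) `^ pbar p)%:E)%E.

(* f is only prescribed almost everywhere: although blocks are Borel, any
   Lebesgue measurable f, and any change of f on a null set, is covered. *)
Definition block_decomposition (p : R) (s : \bar R) (alpha : R) f
    (c : nat -> R[i]) (a : nat -> n.-tuple R -> R[i]) : Prop :=
  [/\ forall k, is_block p s alpha (a k),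
      (coeff_sum_pbar p c < +oo)%E &
      {ae mu, forall x,
        (fun N => normc (\sum_(k < N) c k * a k x - f x)) @ \oo --> (0 : R)}].

Definition BL (p : R) (s : \bar R) (alpha : R) : set (n.-tuple R -> R[i]) :=
  [set f | exists c (a : nat -> n.-tuple R -> R[i]),
          block_decomposition p s alpha f c a].

Definition BLnorm (p : R) (s : \bar R) (alpha : R) f : \bar R :=
  ereal_inf [set ((coeff_sum_pbar p c) `^ (pbar p)^-1)%E
            | c in [set c | exists a : nat -> n.-tuple R -> R[i],
                              block_decomposition p s alpha f c a]].

End block_spaces.

(* Main.v *)
Require Import Defs.
From mathcomp Require Import all_boot all_order all_algebra.
From mathcomp Require Import all_classical all_reals all_analysis.
From mathcomp.real_closed Require Import complex.
From mathcomp Require Import measurable_realfun ring lra.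

(** The maximal Bochner-Riesz operator is controlled pointwise by the
    Hardy-Littlewood maximal function M, and blocks are tailored to the weak
    type inequalities of M.

    Kernel.  Put m = lambda + (n + 1) / 2.  The kernel of index L satisfies
    |K_L(z)| <= C L^n min(1, (L |z|)^-m) ([br_kernel_le]), and m > n is the
    hypothesis on lambda.  Cutting R^n into dyadic cubes of side about 2^j / L
    around x, the integral of F(y) |K_L(x - y)| is at most a convergent
    geometric series times M F(x), uniformly in L, for every Borel function
    F with F >= |f| almost everywhere ([max_bochner_riesz_le_maximal]).  The
    decay needs no Bessel function: on a ray with unit direction w, the function
    y(t) = int (1 - |xi|^2)_+^lambda cos (t w.xi) dxi solves
    y'' + (2 m / t) y' + y = 0 ([radial_ode]), because suitable combinations of
    directional derivatives integrate to zero; and the energy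
    t^(2 m) ((y' + m y / t)^2 + y^2) of this equation stays bounded, so that
    |y(t)| <= C t^-m ([ode_decay]).

    One block.  Put th = 1 + alpha / n.  The measure w = |x|^alpha dx satisfies
    w(E) <= C |E|^th ([weight_measure_le]).  If a is a block on a ball of
    measure V, then F = V^(th / p) |a| is carried by a set of measure V and
    satisfies int F^s <= V, whence |{M F > t}| <= C V min(t^-1, t^-s) by the
    covering lemma ([countable_covering]).  Therefore
    w({M F > t}) <= C V^th min(t^-th, t^-(s th)), and the two strict hypotheses
    on alpha say exactly that th < p < s th: summing over the dyadic levels of
    M F ([layer_cake_le]) bounds int (M a)^p dw by a constant that depends
    neither on the centre nor on the radius of the ball ([block_maximal_le]).

    Sum of blocks.  M is countably subadditive ([HL_maximal_series]), and the
    p-th power of a series is handled by subadditivity for p <= 1 and by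
    convexity for p > 1 ([poweR_pbar_series_le]).

    Functions that are not Borel, such as f, are compared with Borel ones through
    the monotonicity of the integral, a supremum over simple functions
    ([le_integral_nonmeasurable]). *)

Set Implicit Arguments.
Unset Strict Implicit.
Unset Printing Implicit Defensive.

Import Order.TTheory GRing.Theory Num.Theory.
Import numFieldNormedType.Exports.

Local Open Scope classical_set_scope.
Local Open Scope ring_scope.

(** * Affine changes of variables *)
Section affine_change_of_variables.
Context {R : realType}.
Local Notation leb := (@lebesgue_measure R).

Lemma lebesgue_measure_affine (a b : R) (A : set R) : 0 < a -> measurable A ->
  leb ((fun t : R => a * t + b) @^-1` A) = ((a^-1)%:E * leb A)%E.
Proof.
move=> a0 mA.
have mf : measurable_fun [set: measurableTypeR R]
    ((fun t : R => a * t + b) : _ -> measurableTypeR R).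
  apply: measurable_funD; last exact: measurable_cst.
  exact: measurable_funM.
pose m1 := measure_function_pushforward__canonical__measure_function_Measure
  leb mf.
pose m2 := [the {measure set (measurableTypeR R) -> \bar R} of
  mscale (NngNum (ltW a0)) m1].
have E : forall X, measurable X -> leb X = m2 X.
  apply: lebesgue_measure_unique => _ [[x y]] _ <-.
  rewrite /= /mscale /= /pushforward.
  rewrite (_ : _ @^-1` _ = `](x - b) / a, (y - b) / a]%classic); last first.
    apply/seteqP; split => t /=; rewrite !in_itv /= => /andP[h1 h2];
      apply/andP; split.
    - by rewrite ltr_pdivrMr // ltrBlDr mulrC.
    - by rewrite ler_pdivlMr // lerBrDr mulrC.
    - by move: h1; rewrite ltr_pdivrMr // ltrBlDr mulrC.
    - by move: h2; rewrite ler_pdivlMr // lerBrDr mulrC.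
  rewrite !lebesgue_measure_itv /= !lte_fin ltr_pM2r ?invr_gt0 // ltrD2r.
  case: ifP => _; last by rewrite mule0.
  rewrite -!EFinB -EFinM; congr EFin; field; lra.
rewrite [in RHS]E //= /mscale /= /pushforward muleA -EFinM mulVf ?mul1e //.
by rewrite gt_eqF.
Qed.

Definition affine_tuple n (a : R) (v x : n.-tuple R) : n.-tuple R :=
  [tuple a * tnth x i + tnth v i | i < n].

Definition box n (A : 'I_n -> set R) : set (n.-tuple R) :=
  [set x | forall i, A i (tnth x i)].

Lemma measurable_box n (A : 'I_n -> set R) :
  (forall i, measurable (A i)) -> measurable (box A).
Proof.
move=> mA; rewrite (_ : box A = \bigcap_(i in [set: 'I_n])
     ((fun x : n.-tuple R => tnth x i) @^-1` A i)).
  apply: fin_bigcap_measurable => // i _.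
  by rewrite -[X in measurable X]setTI; exact: measurable_tnth.
by apply/seteqP; split => x /= H i; [move=> _|]; exact: H.
Qed.

Lemma measurable_affine_tuple n (a : R) (v : n.-tuple R) :
  measurable_fun [set: n.-tuple R] (affine_tuple a v).
Proof.
apply/measurable_fun_tnthP => i.
rewrite (_ : _ \o _ = fun x => a * tnth x i + tnth v i); last first.
  by apply/funext => x /=; rewrite tnth_mktuple.
apply: measurable_funD; last exact: measurable_cst.
by apply: measurable_funM => //; exact: measurable_tnth.
Qed.

Lemma measurable_tuple_boxes n :
  measurable = <<s [set B : set (n.-tuple R) |
    exists2 A : 'I_n -> set R, (forall i, measurable (A i)) & B = box A] >>.
Proof.
apply/seteqP; split; last first.
  apply: smallest_sub; first exact: sigma_algebra_measurable.
  by move=> _ [A mA ->]; exact: measurable_box.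
apply: smallest_sub; first exact: smallest_sigma_algebra.
rewrite -bigcup_seq => B [i /= _] [A mA <-]; rewrite setTI.
apply: sub_sigma_algebra.
exists (fun j => if j == i then A else setT) => [j|].
  by case: ifP.
apply/seteqP; split => x /= => [Ax j|/(_ i)]; last by rewrite eqxx.
by case: eqP => [->|].
Qed.

(** An increasing sequence of boxes of finite measure that covers the space, as
    the uniqueness of measures requires. *)
Definition symbox n (k : nat) : set (n.-tuple R) :=
  box (fun _ => `[- k%:R, k%:R]%classic).

Lemma tuple_measure_unique n (m1 m2 : {measure set (n.-tuple R) -> \bar R}) :
  (forall A : 'I_n -> set R, (forall i, measurable (A i)) ->
     m1 (box A) = m2 (box A)) ->
  (forall k : nat, m1 (@symbox n k) < +oo)%E ->
  forall B, measurable B -> m1 B = m2 B.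
Proof.
move=> m12 m1oo; apply: (@measure_unique _ _ _ _ (@symbox n) (measurable_tuple_boxes n)) => //.
- move=> _ _ [A mA ->] [B mB ->]; exists (fun i => A i `&` B i).
    by move=> i; exact: measurableI.
  by apply/seteqP; split => x /= => [[h1 h2] i|h];
    [split; [exact: h1|exact: h2]|split => i; case: (h i)].
- by move=> k; exists (fun _ => `[- k%:R, k%:R]%classic).
- apply/seteqP; split => // x _.
  exists (Num.truncn (\sum_i `|tnth x i|)).+1 => // i /=.
  rewrite in_itv /= -ler_norml.
  apply: (@le_trans _ _ (\sum_i `|tnth x i|)).
    by rewrite (bigD1 i) //= lerDl sumr_ge0.
  by apply/ltW; rewrite truncnS_gt.
- by move=> _ [A mA ->]; exact: m12.
Qed.

Lemma prod_EFin (I : finType) (F : I -> R) :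
  (\prod_(i : I) (F i)%:E = (\prod_(i : I) F i)%:E)%E.
Proof.
by elim/big_ind2: _ => // x1 x2 y1 y2 -> ->; rewrite EFinM.
Qed.

(** Both sides are measures in the set, and they agree on boxes, where the
    product formula reduces the claim to dimension one. *)
Lemma lebesgueN_affine n (a : R) (v : n.-tuple R) (A : set (n.-tuple R)) :
  0 < a -> measurable A ->
  lebesgueN n (affine_tuple a v @^-1` A) = ((a ^- n)%:E * lebesgueN n A)%E.
Proof.
move=> a0 mA.
pose m1 := measure_function_pushforward__canonical__measure_function_Measure
  (lebesgueN n) (@measurable_affine_tuple n a v).
have an0 : 0 <= a ^- n by rewrite invr_ge0 exprn_ge0 // ltW.
pose m2 := [the {measure set (n.-tuple R) -> \bar R} of
  mscale (NngNum an0) (lebesgueN n)].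
apply: (@tuple_measure_unique _ m1 m2) => //.
  move=> B mB; rewrite /= /mscale /= /pushforward.
  rewrite (_ : _ @^-1` _ =
      box (fun i => (fun t : R => a * t + tnth v i) @^-1` B i)); last first.
    by apply/seteqP; split => x /= H i; move: (H i); rewrite tnth_mktuple.
  rewrite !lebesgueN_box //; last first.
    move=> i; rewrite -[X in measurable X]setTI.
    suff mf : measurable_fun [set: R] (fun t : R => a * t + tnth v i) by exact: mf.
    apply: measurable_funD; last exact: measurable_cst.
    exact: measurable_funM.
  under eq_bigr do rewrite lebesgue_measure_affine //.
  rewrite big_split /= prod_EFin; congr (_ * _)%E.
  by rewrite prodr_const card_ord exprVn.
move=> k; rewrite /= /pushforward.
rewrite (_ : _ @^-1` _ =
      box (fun i => (fun t : R => a * t + tnth v i) @^-1` `[- k%:R, k%:R]%classic)); last first.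
    by apply/seteqP; split => x /= H i; move: (H i); rewrite tnth_mktuple.
rewrite lebesgueN_box; last first.
  move=> i; rewrite -[X in measurable X]setTI.
  suff mf : measurable_fun [set: R] (fun t : R => a * t + tnth v i) by exact: mf.
  apply: measurable_funD; last exact: measurable_cst.
  exact: measurable_funM.
under eq_bigr do rewrite lebesgue_measure_affine // lebesgue_measure_itv /=.
pose c := (a^-1 * (if (- k%:R < k%:R :> R)%R then k%:R - - k%:R else 0)).
rewrite [X in (X < _)%E](_ : _ = (\prod_(i < n) c%:E)%E); last first.
  by apply: eq_bigr => i _; rewrite lte_fin /c; case: ifP => // _; rewrite mule0 mulr0.
by rewrite prod_EFin ltry.
Qed.

Lemma ge0_integral_affine n (a : R) (v : n.-tuple R) (f : n.-tuple R -> \bar R) :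
  0 < a -> measurable_fun setT f -> (forall x, 0 <= f x)%E ->
  (\int[lebesgueN n]_x f (affine_tuple a v x) =
   (a ^- n)%:E * \int[lebesgueN n]_x f x)%E.
Proof.
move=> a0 mf f0.
have an0 : 0 <= a ^- n by rewrite invr_ge0 exprn_ge0 // ltW.
rewrite -(@ge0_integral_mscale _ _ _ _ _ _ (NngNum an0)) //.
rewrite -[LHS](@ge0_integral_pushforward _ _ _ _ _ _
  (@measurable_affine_tuple n a v) (lebesgueN n) setT f) //.
apply: eq_measure_integral => [|mf1 A mA _]; first exact: measurable_affine_tuple.
exact: (@lebesgueN_affine n a v A a0 mA).
Qed.

(** A positive real factor distributes even over +oo - +oo, both sides being
    -oo. *)
Lemma gt0_muleBr (c : R) (x y : \bar R) : 0 < c ->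
  (c%:E * (x - y) = c%:E * x - c%:E * y)%E.
Proof.
move=> c0; move: x y => [x| |] [y| |];
  by rewrite ?gt0_muley ?gt0_muleNy ?lte_fin //= -?EFinM ?mulrBr.
Qed.

(** An infinite integral has the real value 0 by convention, on both sides. *)
Lemma Rintegral_affine n (a : R) (v : n.-tuple R) (f : n.-tuple R -> R) :
  0 < a -> measurable_fun setT f ->
  \int[lebesgueN n]_x f (affine_tuple a v x) =
  a ^- n * \int[lebesgueN n]_x f x.
Proof.
move=> a0 mf; rewrite /Rintegral.
have mF : measurable_fun setT (EFin \o f) by exact/measurable_EFinP.
have E : (\int[lebesgueN n]_x (f (affine_tuple a v x))%:E =
   (a ^- n)%:E * \int[lebesgueN n]_x (f x)%:E)%E.
  rewrite [in RHS]integralE.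
  transitivity ((\int[lebesgueN n]_x ((EFin \o f)^\+ (affine_tuple a v x))) -
      \int[lebesgueN n]_x ((EFin \o f)^\- (affine_tuple a v x)))%E.
    rewrite integralE; congr (_ - _)%E; apply: eq_integral => x _.
      by rewrite !funeposE.
    by rewrite !funenegE.
  rewrite (ge0_integral_affine v a0 (measurable_funepos mF)) //.
  rewrite (ge0_integral_affine v a0 (measurable_funeneg mF)) //.
  by rewrite [RHS]gt0_muleBr ?invr_gt0 ?exprn_gt0.
case: (\int[lebesgueN n]_x (f x)%:E)%E E => [r| |] E; rewrite E //=.
  by rewrite gt0_muley ?mulr0 //= lte_fin invr_gt0 exprn_gt0.
by rewrite gt0_muleNy ?mulr0 //= lte_fin invr_gt0 exprn_gt0.
Qed.

End affine_change_of_variables.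

(** * Integrals of arbitrary nonnegative functions *)
Section lower_integral.
Context d (T : measurableType d) {R : realType} (mu : {measure set T -> \bar R}).
Local Open Scope ereal_scope.

(** The integral of a nonnegative function is the supremum of the integrals of
    the simple functions below it. *)
Lemma le_integral_nonmeasurable (D : set T) (f g : T -> \bar R) :
  (forall x, D x -> 0 <= f x) -> (forall x, D x -> f x <= g x) ->
  \int[mu]_(x in D) f x <= \int[mu]_(x in D) g x.
Proof.
move=> f0 fg; have g0 x (Dx : D x) : 0 <= g x by exact: (le_trans (f0 _ Dx) (fg _ Dx)).
rewrite !ge0_integralE //.
apply: le_ereal_sup => _ [h /= hf <-]; exists h => //= x.
apply: (le_trans (hf x)); rewrite /patch; case: ifPn => //.
by rewrite inE => /fg.
Qed.

End lower_integral.

(** * Euclidean norm, cubes and the covering lemma *)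
Section measurability.
Context {R : realType} {n : nat}.

Lemma measurable_enorm : measurable_fun [set: n.-tuple R] (@enorm R n).
Proof.
apply: (@measurableT_comp _ _ _ _ _ _ (@Num.sqrt R)).
  by apply: continuous_measurable_fun; exact: sqrt_continuous.
by apply: measurable_sum => i; apply: measurable_funX; exact: measurable_tnth.
Qed.

Lemma measurable_dot_tuple (w : n.-tuple R) :
  measurable_fun [set: n.-tuple R] (dot_tuple w).
Proof.
apply: measurable_sum => i; apply: measurable_funM => //.
exact: measurable_tnth.
Qed.

Lemma measurable_sub_tuple (x : n.-tuple R) :
  measurable_fun [set: n.-tuple R] (fun y => sub_tuple y x).
Proof.
apply/measurable_fun_tnthP => i.
rewrite (_ : _ \o _ = fun y => tnth y i - tnth x i); last first.
  by apply/funext => y /=; rewrite tnth_mktuple.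
by apply: measurable_funB => //; exact: measurable_tnth.
Qed.

Lemma enorm_ge0 (x : n.-tuple R) : 0 <= enorm x.
Proof. exact: sqrtr_ge0. Qed.

Lemma enormE (x : n.-tuple R) : enorm x ^+ 2 = \sum_(i < n) tnth x i ^+ 2.
Proof. by rewrite sqr_sqrtr // sumr_ge0 // => i _; exact: sqr_ge0. Qed.

Lemma tnth_le_enorm (x : n.-tuple R) i : `|tnth x i| <= enorm x.
Proof.
rewrite -(ler_pXn2r (_ : 0 < 2)%N) ?nnegrE ?enorm_ge0 // enormE real_normK ?num_real //.
by rewrite (bigD1 i) //= lerDl sumr_ge0 // => j _; exact: sqr_ge0.
Qed.

Lemma measurable_eball (x : n.-tuple R) r : measurable (eball x r).
Proof.
rewrite (_ : eball x r = (fun y => enorm (sub_tuple y x)) @^-1` `]-oo, r]%classic).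
  rewrite -[X in measurable X]setTI.
  have mf := measurableT_comp measurable_enorm (@measurable_sub_tuple x).
  exact: mf.
by apply/seteqP; split => y /=; rewrite in_itv.
Qed.

End measurability.

Section cubes.
Context {R : realType} {n : nat}.
Local Notation mu := (@lebesgueN R n).
Implicit Types (c x : n.-tuple R).

Definition cube c (r : R) : set (n.-tuple R) :=
  [set x | forall i, `|tnth x i - tnth c i| <= r].

Lemma cube_box c r :
  cube c r = box (fun i => `[tnth c i - r, tnth c i + r]%classic).
Proof.
by apply/seteqP; split => x /= H i; move: (H i);
  rewrite /= in_itv /= ler_distl.
Qed.

Lemma measurable_cube c r : measurable (cube c r).
Proof. by rewrite cube_box; exact: measurable_box. Qed.

Lemma lebesgueN_cube c r : 0 <= r -> mu (cube c r) = ((2 * r) ^+ n)%:E.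
Proof.
move=> r0; rewrite cube_box lebesgueN_box //.
transitivity (\prod_(i < n) (2 * r)%:E)%E.
  apply: eq_bigr => i _; rewrite lebesgue_measure_itv /= lte_fin.
  case: ifPn => [_|]; first by rewrite -EFinB; congr EFin; ring.
  rewrite -leNgt => h; congr EFin; lra.
by rewrite prod_EFin prodr_const card_ord.
Qed.

Lemma cube_center c r : 0 <= r -> cube c r c.
Proof. by move=> r0 i; rewrite subrr normr0. Qed.

Lemma cube_eball c r : eball c r `<=` cube c r.
Proof.
move=> x h i; apply: le_trans h.
by have := tnth_le_enorm (sub_tuple x c) i; rewrite tnth_mktuple.
Qed.

Lemma eball_cube c r : 0 <= r -> cube c (r / n%:R) `<=` eball c r.
Proof.
move=> r0 x h; rewrite /eball /= -(ler_pXn2r (_ : 0 < 2)%N) ?nnegrE ?enorm_ge0 //.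
rewrite enormE; case: (posnP n) => [n0|n0].
  by rewrite big1 ?sqr_ge0 // => i _; case: i => i Hi; exfalso; rewrite n0 in Hi.
have n1 : (1 : R) <= n%:R by rewrite ler1n.
apply: (@le_trans _ _ (\sum_(i < n) (r / n%:R) ^+ 2)).
  apply: ler_sum => i _; rewrite tnth_mktuple -real_normK ?num_real //.
  by rewrite ler_pXn2r ?nnegrE // (le_trans _ (h i)).
rewrite sumr_const card_ord -[leLHS]mulr_natl expr_div_n.
move: n1; set N : R := n%:R => n1.
rewrite (_ : N * (r ^+ 2 / N ^+ 2) = r ^+ 2 / N); last by field; lra.
rewrite ler_pdivrMr; last by lra.
by rewrite ler_peMr ?sqr_ge0.
Qed.

Lemma lebesgueN_eball_gt0 c r : 0 < r -> (0 < mu (eball c r))%E.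
Proof.
move=> r0; case: (posnP n) => [n0|n0].
  have h : mu (cube c r) = 1%E.
    rewrite lebesgueN_cube ?(ltW r0) //.
    by rewrite [X in _ ^+ X]n0.
  apply: (@lt_le_trans _ _ (mu (cube c r))); first by rewrite h lte_fin.
  apply: le_measure; rewrite ?inE; [exact: measurable_cube|exact: measurable_eball|].
  move=> x _; rewrite /eball /= /enorm big1 ?sqrtr0 ?(ltW r0) //.
  by move=> i _; case: i => i Hi; exfalso; rewrite n0 in Hi.
apply: (@lt_le_trans _ _ (mu (cube c (r / n%:R)))).
  rewrite lebesgueN_cube ?lte_fin ?exprn_gt0 //.
    by rewrite mulr_gt0 // divr_gt0 ?ltr0n.
  by rewrite divr_ge0 ?(ltW r0).
apply: le_measure; rewrite ?inE; [exact: measurable_cube|exact: measurable_eball|].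
exact: eball_cube (ltW r0).
Qed.

Lemma lebesgueN_eball_fin c r : 0 < r -> (mu (eball c r) < +oo)%E.
Proof.
move=> r0; apply: (@le_lt_trans _ _ (mu (cube c r))).
  apply: le_measure; rewrite ?inE; [exact: measurable_eball|exact: measurable_cube|].
  exact: cube_eball.
by rewrite lebesgueN_cube ?(ltW r0) // ltry.
Qed.

Lemma cube_triple c c' r r' x : r' <= r -> cube c r x -> cube c' r' x ->
  cube c' r' `<=` cube c (3 * r).
Proof.
move=> rr hx hx' y hy i.
have := hx i; have := hx' i; have := hy i.
rewrite !ler_norml => /andP[a1 a2] /andP[b1 b2] /andP[c1 c2].
apply/andP; split; lra.
Qed.

(** The selection argument of Vitali's lemma, carried out on the measures
    themselves: the largest cube and the cubes that meet it lie in its triple,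
    whose measure is 3^n times larger, and the induction hypothesis applies to
    the cubes that are disjoint from it. *)
Lemma finite_covering (I : choiceType) (c : I -> n.-tuple R) (r : I -> R)
    (phi : n.-tuple R -> \bar R) (s : seq I) :
  measurable_fun setT phi -> (forall x, 0 <= phi x)%E ->
  (forall i, 0 <= r i) ->
  (forall i, i \in s -> mu (cube (c i) (r i)) <=
     \int[mu]_(x in cube (c i) (r i)) phi x)%E ->
  (mu (\bigcup_(i in [set` s]) cube (c i) (r i)) <= (3 ^+ n)%:E *
    \int[mu]_(x in (\bigcup_(i in [set` s]) cube (c i) (r i))%classic) phi x)%E.
Proof.
move=> mphi phi0 r0; have [k] := ubnP (size s).
elim: k s => // k IHk s; rewrite ltnS => sk hs.
have mU (t : seq I) : measurable (\bigcup_(i in [set` t]) cube (c i) (r i)).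
  rewrite bigcup_seq; apply: bigsetU_measurable => i _; exact: measurable_cube.
case: s sk hs => [|i0 s0] sk hs.
  rewrite set_nil bigcup_set0 measure0 mule_ge0 ?lee_fin ?exprn_ge0 //.
  by rewrite integral_ge0.
set s := i0 :: s0 in sk hs *.
have [i si imax] : exists2 i, i \in s & forall j, j \in s -> r j <= r i.
  have : s != [::] by [].
  elim: {hs sk} s => // a [_ _|b t IH _].
    by exists a; rewrite ?mem_head // => j; rewrite inE => /eqP ->.
  have [//|i it imax] := IH.
  have [h|h] := leP (r a) (r i).
    exists i; first by rewrite inE it orbT.
    by move=> j; rewrite inE => /orP[/eqP ->//|/imax].
  exists a; first by rewrite mem_head.
  move=> j; rewrite inE => /orP[/eqP ->//|/imax h2].
  exact: le_trans h2 (ltW h).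
pose Q j := cube (c j) (r j).
(* The cubes that are left for the induction hypothesis. *)
pose s1 := [seq j <- s | `[< Q j `&` Q i = set0 >]].
have Qi : ~~ `[< Q i `&` Q i = set0 >].
  apply/negP => /asboolP; rewrite setIid => h.
  suff : Q i (c i) by rewrite h.
  exact: cube_center.
have ss1 : (size s1 < k)%N.
  apply: leq_trans sk; rewrite size_filter ltn_neqAle count_size andbT.
  by rewrite -all_count; apply/negP => /allP /(_ _ si) h; rewrite h in Qi.
have IH : (mu (\bigcup_(i in [set` s1]) Q i) <= (3 ^+ n)%:E *
    \int[mu]_(x in (\bigcup_(i in [set` s1]) Q i)%classic) phi x)%E.
  by apply: IHk => // j; rewrite mem_filter => /andP[_ /hs].
have sub : \bigcup_(j in [set` s]) Q j `<=`
    cube (c i) (3 * r i) `|` \bigcup_(j in [set` s1]) Q j.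
  move=> x [j /= js Qj].
  have [h|h] := pselect (Q j `&` Q i = set0).
    by right; exists j => //=; rewrite mem_filter js andbT; exact/asboolP.
  left; have [y [yj yi]] : Q j `&` Q i !=set0 by apply/set0P/eqP.
  exact: (cube_triple (imax _ js) yi yj).
apply: (@le_trans _ _ (mu (cube (c i) (3 * r i) `|` \bigcup_(j in [set` s1]) Q j))).
  apply: le_measure; rewrite ?inE //; apply: measurableU => //.
  exact: measurable_cube.
apply: (le_trans (measureU2 _ _ _)) => //; first exact: measurable_cube.
have E3 : mu (cube (c i) (3 * r i)) = ((3 ^+ n)%:E * mu (Q i))%E.
  rewrite /Q !lebesgueN_cube ?mulr_ge0 // -EFinM; congr EFin.
  by rewrite -exprMn; congr (_ ^+ _); ring.
rewrite [X in (X + _ <= _)%E](_ : _ = ((3 ^+ n)%:E * mu (Q i))%E); last exact: E3.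
apply: (@le_trans _ _ ((3 ^+ n)%:E * (\int[mu]_(x in Q i) phi x) + (3 ^+ n)%:E *
    \int[mu]_(x in (\bigcup_(i in [set` s1]) Q i)%classic) phi x)%E).
  apply: leeD => //; apply: lee_wpmul2l; first by rewrite lee_fin exprn_ge0.
  exact: hs.
rewrite -ge0_muleDr; [|exact: integral_ge0|exact: integral_ge0].
apply: lee_wpmul2l; first by rewrite lee_fin exprn_ge0.
rewrite -ge0_integral_setU //; last 3 first.
- exact: measurable_cube.
- exact: measurable_funTS.
- apply/disj_setPLR => x Qix [j /=]; rewrite mem_filter => /andP[/asboolP h _] Qjx.
  by have : (Q j `&` Q i) x by []; rewrite h.
apply: ge0_subset_integral => //.
- by apply: measurableU => //; exact: measurable_cube.
- exact: measurable_funTS.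
- move=> x [Qx|[j /=]]; first by exists i.
  by rewrite mem_filter => /andP[_ js] Qx; exists j.
Qed.

Lemma countable_covering (D : set nat) (c : nat -> n.-tuple R) (r : nat -> R)
    (phi : n.-tuple R -> \bar R) :
  measurable_fun setT phi -> (forall x, 0 <= phi x)%E ->
  (forall i, 0 <= r i) ->
  (forall i, D i -> mu (cube (c i) (r i)) <=
     \int[mu]_(x in cube (c i) (r i)) phi x)%E ->
  (mu (\bigcup_(i in D) cube (c i) (r i)) <= (3 ^+ n)%:E * \int[mu]_x phi x)%E.
Proof.
move=> mphi phi0 r0 hD.
pose s N := [seq j <- iota 0 N | `[< D j >]].
pose U N := \bigcup_(i in [set` s N]) cube (c i) (r i).
have mU N : measurable (U N).
  rewrite /U bigcup_seq; apply: bigsetU_measurable => i _; exact: measurable_cube.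
have UE : \bigcup_(i in D) cube (c i) (r i) = \bigcup_N U N.
  apply/seteqP; split => x [j Dj Qx].
    exists j.+1 => //; exists j => //=.
    rewrite mem_filter mem_iota add0n ltnS leqnn /= andbT; exact/asboolP.
  by case: Qx => i /=; rewrite mem_filter => /andP[/asboolP Di _] Qi; exists i.
have ndU : nondecreasing_seq U.
  move=> a b ab; apply/subsetPset => x [j /=].
  rewrite mem_filter mem_iota add0n => /andP[h1 /= h2] Qx.
  by exists j => //=; rewrite mem_filter h1 mem_iota add0n /= (leq_trans h2).
rewrite UE.
have cv : mu (U N) @[N --> \oo] --> mu (\bigcup_N U N).
  by apply: nondecreasing_cvg_mu => //; exact: bigcupT_measurable.
rewrite -(cvg_lim _ cv) //; apply: lime_le.
  by apply/cvg_ex; eexists; exact: cv.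
apply: nearW => N; apply: le_trans (finite_covering (s := s N) mphi phi0 r0 _) _.
  by move=> i; rewrite mem_filter => /andP[/asboolP /hD].
apply: lee_wpmul2l; first by rewrite lee_fin exprn_ge0.
by apply: ge0_subset_integral => //; exact: mU.
Qed.

End cubes.

(** * Integration over dyadic levels *)
Section layer_cake.
Context {R : realType}.
Local Open Scope ereal_scope.

Lemma powR2_lt1 (x : R) : (x < 0)%R -> (2 `^ x < 1 :> R)%R.
Proof.
move=> x0; rewrite /powR pnatr_eq0 /= expR_lt1 nmulr_rlt0 //.
by rewrite ln_gt0 // ltr1n.
Qed.

Lemma nneseries_geometric (A z : R) : (0 <= A)%R -> (0 <= z < 1)%R ->
  \sum_(0 <= k <oo) (A * z ^+ k)%:E <= (A / (1 - z))%:E.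
Proof.
move=> A0 /andP[z0 z1]; apply: lime_le.
  by apply: is_cvg_nneseries => k _ _; rewrite lee_fin mulr_ge0 ?exceeds_ge0 // exprn_ge0.
apply: nearW => k; rewrite sumEFin lee_fin.
have [->|zn0] := eqVneq z 0%R.
  rewrite subr0 divr1; case: k => [|k]; first by rewrite big_nil.
  rewrite big_nat_recl // expr0 mulr1 big1 ?addr0 // => i _.
  by rewrite expr0n mulr0.
apply: geometric_le_lim => //; first by rewrite lt_neqAle eq_sym zn0.
by rewrite ger0_norm.
Qed.

Lemma nneseries_ge_term (u : nat -> \bar R) k : (forall i, 0 <= u i) ->
  u k <= \sum_(0 <= i <oo) u i.
Proof.
move=> u0; rewrite (@nneseriesD1 _ _ k) // leeDl //.
by apply: nneseries_ge0.
Qed.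

(** A real-valued indicator, to be used as a coefficient in series. *)
Definition exceeds (t : R) (g : \bar R) : R := ((t%:E < g)%E%:R)%R.

Lemma exceeds_ge0 t g : (0 <= exceeds t g)%R.
Proof. exact: ler0n. Qed.

(** If g lies in ]2^k, 2^(k+1)], the term of index k alone dominates g^q.  The
    first series serves the values above 1 and diverges at g = +oo; the second
    one serves the values in ]0, 1]. *)
Lemma poweR_le_dyadic_levels (q : R) (g : \bar R) : (0 < q)%R -> 0 <= g ->
  g `^ q <=
    \sum_(0 <= k <oo) (((2 `^ q) * (2 `^ q) ^+ k)%R * exceeds (2 ^+ k) g)%:E +
    \sum_(0 <= k <oo) (((2 `^ (- q)) ^+ k)%R * exceeds (2 ^- k.+1) g)%:E.
Proof.
move=> q0; have two0 : (0 < 2 :> R)%R by [].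
have pw0 e k : (0 <= (2 `^ e) ^+ k :> R)%R by rewrite exprn_ge0 // powR_ge0.
have pwE e k : ((2 `^ e) ^+ k = (2 ^+ k) `^ e :> R)%R.
  by rewrite -!powR_mulrn ?powR_ge0 // -!powRrM mulrC.
set u := (X in \sum_(0 <= k <oo) X k + _).
set v := (X in _ + \sum_(0 <= k <oo) X k).
have u0 k : 0 <= u k by rewrite lee_fin mulr_ge0 ?exceeds_ge0 // mulr_ge0 ?powR_ge0.
have v0 k : 0 <= v k by rewrite lee_fin mulr_ge0.
have su0 : 0 <= \sum_(0 <= k <oo) u k by exact: nneseries_ge0.
have sv0 : 0 <= \sum_(0 <= k <oo) v k by exact: nneseries_ge0.
case: g => [g| |] // in u v u0 v0 su0 sv0 *; last first.
  move=> _; suff -> : \sum_(0 <= k <oo) u k = +oo by rewrite addye ?leey // gt_eqF // (lt_le_trans _ sv0) // ltNy0.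
  apply/eqyP => r r0.
  have [k hk] : exists k : nat, (r <= k%:R)%R.
    by exists (Num.truncn r).+1; apply/ltW; rewrite truncnS_gt.
  apply: (@le_trans _ _ (\sum_(0 <= i < k) u i)); last exact: nneseries_lim_ge.
  apply: (@le_trans _ _ (\sum_(0 <= i < k) 1%:E)).
    by rewrite sumEFin lee_fin sumr_const_nat subn0.
  apply: lee_sum => i _; rewrite /u /exceeds ltry mulr1 lee_fin.
  have h : (1 <= 2 `^ q :> R)%R by rewrite -[leLHS](powRr0 2) ler_powR ?ler1n ?ltW.
  by rewrite mulr_ege1 // exprn_ege1.
rewrite lee_fin => g0.
have [->|gn0] := eqVneq g 0%R; first by rewrite poweR0r ?gt_eqF // adde_ge0.
have {gn0}gp : (0 < g)%R by rewrite lt_neqAle eq_sym gn0.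
have [g1|g1] := leP g 1%R.
  have ex : exists k : nat, (2 ^- k.+1 < g)%R.
    exists (Num.truncn g^-1).
    rewrite -[ltRHS]invrK ltf_pV2 ?posrE ?exprn_gt0 ?invr_gt0 //.
    apply: (lt_le_trans (truncnS_gt _)).
    by rewrite -natrX ler_nat; exact/ltnW/ltn_expl.
  have kP := ex_minnP ex; case: kP => k hk kmin.
  have gk : (g <= 2 ^- k)%R.
    case: k hk kmin => [|k] hk kmin; first by rewrite expr0 invr1.
    by rewrite leNgt; apply/negP => /kmin; rewrite ltnn.
  apply: (@le_trans _ _ (v k)); last first.
    by apply: (le_trans (nneseries_ge_term k v0)); rewrite leeDr.
  rewrite /v /exceeds lte_fin hk mulr1 lee_fin pwE.
  rewrite powRN -[leRHS]powR_inv1 ?powR_ge0 // -powRrM mulrC powRrM.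
  rewrite ge0_ler_powR ?nnegrE ?(ltW q0) // ?powR_ge0 //.
  by rewrite powR_inv1 // exprn_ge0.
have ex : exists k : nat, (g <= 2 ^+ k.+1)%R.
  exists (Num.truncn g); apply/ltW/(lt_le_trans (truncnS_gt _)).
  by rewrite -natrX ler_nat; exact/ltnW/ltn_expl.
have kP := ex_minnP ex; case: kP => k hk kmin.
have gk : (2 ^+ k < g)%R.
  case: k hk kmin => [|k] hk kmin; first by rewrite expr0.
  by rewrite ltNge; apply/negP => /kmin; rewrite ltnn.
apply: (@le_trans _ _ (u k)); last first.
  by apply: (le_trans (nneseries_ge_term k u0)); rewrite leeDl.
rewrite /u /exceeds lte_fin gk mulr1 lee_fin -exprS pwE.
by rewrite ge0_ler_powR ?nnegrE ?(ltW q0) // exprn_ge0.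
Qed.

Context d (T : measurableType d) (mu : {measure set T -> \bar R}).

(** The values of the two geometric series met when the levels above 1 are
    estimated with the exponent b and those below 1 with the exponent a. *)
Definition layer_cake_const (a b q : R) : R :=
  (2 `^ q / (1 - 2 `^ (q - b)) + 2 `^ a / (1 - 2 `^ (a - q)))%R.

Lemma layer_cake_const_ge0 (a b q : R) : (a < q)%R -> (q < b)%R ->
  (0 <= layer_cake_const a b q)%R.
Proof.
have h (x : R) : (x < 0)%R -> (0 <= 1 - 2 `^ x :> R)%R.
  by move=> x0; rewrite subr_ge0 -[leRHS](powRr0 2) ler_powR ?ler1n ?ltW.
move=> aq qb; rewrite addr_ge0 // divr_ge0 ?powR_ge0 // h // ; lra.
Qed.

(** Marcinkiewicz interpolation for one function: two weak type bounds at
    exponents a < q < b, which cross at the level t = 1, give a strong bound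
    at q. *)
Lemma layer_cake_le (a b q N : R) (g : T -> \bar R) (h : T -> R) :
  (0 < q)%R -> (a < q)%R -> (q < b)%R -> (0 <= N)%R ->
  measurable_fun setT g -> (forall x, 0 <= g x) ->
  measurable_fun setT h -> (forall x, (0 <= h x)%R) ->
  (forall t : R, (0 < t)%R ->
     \int[mu]_(x in [set x | t%:E < g x]) (h x)%:E <= (N * t `^ (- a))%:E) ->
  (forall t : R, (0 < t)%R ->
     \int[mu]_(x in [set x | t%:E < g x]) (h x)%:E <= (N * t `^ (- b))%:E) ->
  \int[mu]_x (g x `^ q * (h x)%:E) <= (layer_cake_const a b q * N)%:E.
Proof.
move=> q0 aq qb N0 mg g0 mh h0 Ha Hb.
have mh' : measurable_fun setT (EFin \o h) by exact/measurable_EFinP.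
have pwE e k : ((2 `^ e) ^+ k = (2 ^+ k) `^ e :> R)%R.
  by rewrite -!powR_mulrn ?powR_ge0 // -!powRrM mulrC.
pose E t := [set x | t%:E < g x].
have mE t : measurable (E t).
  rewrite /E -[X in measurable X]setTI.
  by apply: emeasurable_fun_o_infty.
pose U k (x : T) := (((2 `^ q) * (2 `^ q) ^+ k)%R * exceeds (2 ^+ k) (g x))%:E * (h x)%:E.
pose V k (x : T) := ((((2 `^ (- q)) ^+ k)%R * exceeds (2 ^- k.+1) (g x)))%:E * (h x)%:E.
have mI c t : measurable_fun setT (fun x => (c * exceeds t (g x))%:E * (h x)%:E).
  apply: emeasurable_funM => //; apply/measurable_EFinP.
  apply: measurable_funM => //.
  rewrite (_ : (fun x => _) = \1_(E t)); first exact: measurable_indic.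
  apply/funext => x; rewrite indicE; congr (nat_of_bool _)%:R.
  by apply/idP/idP; rewrite inE.
have iI c t : (0 <= c)%R ->
    \int[mu]_x ((c * exceeds t (g x))%:E * (h x)%:E) = c%:E * \int[mu]_(x in E t) (h x)%:E.
  move=> c0; rewrite [in RHS]integral_mkcond -ge0_integralZl //; last 2 first.
  - by apply/(measurable_restrictT _ _).1 => //; exact: measurable_funTS.
  - by move=> x _; rewrite /patch; case: ifP; rewrite ?lee_fin.
  apply: eq_integral => x _; rewrite /patch EFinM -muleA /exceeds; congr (_ * _).
  have [h1|h1] := boolP (t%:E < g x).
    by rewrite mem_set // mul1e.
  by rewrite memNset ?mul0e //; exact/negP.
have U0 k x : 0 <= U k x.
  by rewrite /U -EFinM lee_fin !mulr_ge0 ?exceeds_ge0 ?exprn_ge0 ?powR_ge0.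
have V0 k x : 0 <= V k x.
  by rewrite /V -EFinM lee_fin !mulr_ge0 ?exceeds_ge0 ?exprn_ge0 ?powR_ge0.
apply: (@le_trans _ _ (\int[mu]_x ((\sum_(0 <= k <oo) U k x) +
    \sum_(0 <= k <oo) V k x))).
  apply: le_integral_nonmeasurable => x _.
    by rewrite mule_ge0 ?poweR_ge0 ?lee_fin.
  apply: (@le_trans _ _ ((\sum_(0 <= k <oo) (((2 `^ q) * (2 `^ q) ^+ k)%R * exceeds (2 ^+ k) (g x))%:E +
    \sum_(0 <= k <oo) (((2 `^ (- q)) ^+ k)%R * exceeds (2 ^- k.+1) (g x))%:E) * (h x)%:E)).
    by apply: lee_wpmul2r; rewrite ?lee_fin //; exact: poweR_le_dyadic_levels.
  rewrite ge0_muleDl; last 2 first.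
  - by apply: nneseries_ge0 => k _ _; rewrite lee_fin mulr_ge0 ?exceeds_ge0 // mulr_ge0 ?exprn_ge0 ?powR_ge0.
  - by apply: nneseries_ge0 => k _ _; rewrite lee_fin mulr_ge0 ?exceeds_ge0 // exprn_ge0 ?powR_ge0.
  rewrite ![_ * (h x)%:E]muleC -!nneseriesZl; last 2 first.
  - by move=> k _; rewrite lee_fin mulr_ge0 ?exceeds_ge0 // exprn_ge0 ?powR_ge0.
  - by move=> k _; rewrite lee_fin mulr_ge0 ?exceeds_ge0 // mulr_ge0 ?exprn_ge0 ?powR_ge0.
  by apply: leeD; apply: lee_nneseries => k *; rewrite muleC ?U0 ?V0.
have mU k : measurable_fun setT (U k) by exact: mI.
have mV k : measurable_fun setT (V k) by exact: mI.
rewrite ge0_integralD //; last 4 first.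
- by move=> x _; exact: nneseries_ge0.
- by apply: ge0_emeasurable_sum.
- by move=> x _; exact: nneseries_ge0.
- by apply: ge0_emeasurable_sum.
rewrite !integral_nneseries //.
rewrite /layer_cake_const mulrDl EFinD; apply: leeD.
  apply: (@le_trans _ _ (\sum_(0 <= k <oo) ((2 `^ q * N) * (2 `^ (q - b)) ^+ k)%:E)).
    apply: lee_nneseries => k _; first by move=> _; exact: integral_ge0.
    rewrite /U iI ?mulr_ge0 ?exprn_ge0 ?powR_ge0 //.
    apply: (@le_trans _ _ ((2 `^ q * (2 `^ q) ^+ k)%:E * (N * (2 ^+ k) `^ (- b))%:E)).
      apply: lee_wpmul2l; first by rewrite lee_fin mulr_ge0 ?exprn_ge0 ?powR_ge0.
      by apply: Hb; rewrite exprn_gt0.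
    rewrite -EFinM lee_fin !pwE powRD ?(gt_eqF (exprn_gt0 _ _)) ?implybT //.
    by rewrite le_eqVlt; apply/orP; left; apply/eqP; ring.
  apply: (le_trans (nneseries_geometric _ _)).
  - by rewrite mulr_ge0 // powR_ge0.
  - by rewrite powR_ge0 /= powR2_lt1 // subr_lt0.
  - by rewrite lee_fin le_eqVlt; apply/orP; left; apply/eqP; ring.
apply: (@le_trans _ _ (\sum_(0 <= k <oo) ((2 `^ a * N) * (2 `^ (a - q)) ^+ k)%:E)).
  apply: lee_nneseries => k _; first by move=> _; exact: integral_ge0.
  rewrite /V iI ?exprn_ge0 ?powR_ge0 //.
  apply: (@le_trans _ _ (((2 `^ (- q)) ^+ k)%:E * (N * (2 ^- k.+1) `^ (- a))%:E)).
    apply: lee_wpmul2l; first by rewrite lee_fin exprn_ge0 ?powR_ge0.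
    by apply: Ha; rewrite invr_gt0 exprn_gt0.
  have -> : ((2 ^- k.+1) `^ (- a) = 2 `^ a * (2 `^ a) ^+ k :> R)%R.
    rewrite -exprS pwE -powR_invn // -powRrM mulrNN powRrM.
    by rewrite powR_mulrn.
  rewrite -EFinM lee_fin powRD ?pnatr_eq0 ?implybT // exprMn.
  by rewrite le_eqVlt; apply/orP; left; apply/eqP; ring.
apply: (le_trans (nneseries_geometric _ _)).
- by rewrite mulr_ge0 // powR_ge0.
- by rewrite powR_ge0 /= powR2_lt1 // subr_lt0.
- by rewrite lee_fin le_eqVlt; apply/orP; left; apply/eqP; ring.
Qed.

End layer_cake.

(** * The power weight *)
Section power_weight.
Context {R : realType} {n : nat}.
Local Notation mu := (@lebesgueN R n).

Lemma measurable_weight (alpha : R) :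
  measurable_fun [set: n.-tuple R] (fun x => enorm x `^ alpha).
Proof.
by apply: (@measurableT_comp _ _ _ _ _ _ (fun x : R => x `^ alpha)); [exact: measurable_powR|exact: measurable_enorm].
Qed.

(** For alpha < 0 the level sets of |x|^alpha are balls about the origin, of
    measure at most a constant times t^(n / alpha), while E meets them in
    measure at most V; the exponents 0 < 1 < n / (- alpha) then feed
    [layer_cake_le]. *)
Lemma weight_measure_le (alpha : R) : (0 < n)%N -> - n%:R < alpha -> alpha <= 0 ->
  exists2 C : R, 0 <= C & forall (E : set (n.-tuple R)) (V : R),
    measurable E -> 0 < V -> (mu E <= V%:E)%E ->
    (\int[mu]_(x in E) (enorm x `^ alpha)%:E <=
      (C * V `^ (1 + alpha / n%:R))%:E)%E.
Proof.
move=> n0 an; rewrite le_eqVlt => /orP[/eqP ->|a0].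
  exists 1 => // E V mE V0 EV.
  under eq_integral do rewrite powRr0.
  by rewrite integral_cst // mul1e mul0r addr0 powRr1 ?mul1r // ltW.
have nR : 0 < n%:R :> R by rewrite ltr0n.
pose b := n%:R / (- alpha).
have na0 : 0 < - alpha by rewrite oppr_gt0.
have anz : alpha != 0 by rewrite lt_eqF.
have b1 : 1 < b by rewrite ltr_pdivlMr // mul1r ltrNl.
pose C := layer_cake_const 0 b 1 * 2 ^+ n.
have C0 : 0 <= C by rewrite mulr_ge0 ?exprn_ge0 // layer_cake_const_ge0.
exists C => // E V mE V0 EV.
(* The level at which the two bounds V and t^(n / alpha) agree. *)
pose t0 := V `^ (alpha / n%:R).
have t00 : 0 < t0 by rewrite powR_gt0.
pose g (x : n.-tuple R) : \bar R := (t0^-1 * enorm x `^ alpha)%:E.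
have gpos x : (0 <= g x)%E.
  by rewrite lee_fin mulr_ge0 ?powR_ge0 // invr_ge0 ltW.
have mg : measurable_fun setT g.
  apply/measurable_EFinP; apply: measurable_funM => //; exact: measurable_weight.
have N0 : 0 <= 2 ^+ n * V by rewrite mulr_ge0 ?exprn_ge0 // ltW.
have mE1 : measurable_fun setT (\1_E : n.-tuple R -> R) by exact: measurable_indic.
have mL t : measurable [set x | (t%:E < g x)%E].
  by rewrite -[X in measurable X]setTI; apply: emeasurable_fun_o_infty.
have iE t : (\int[mu]_(x in [set x | t%:E < g x]) (\1_E x)%:E)%E =
    mu (E `&` [set x | (t%:E < g x)%E]).
  by rewrite integral_indic.
have := @layer_cake_le _ _ _ mu 0 b 1 (2 ^+ n * V) g (\1_E) ltr01 ltr01 b1 N0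
  mg gpos mE1 (fun x => ler0n _ _).
have H1 t : 0 < t -> (\int[mu]_(x in [set x | t%:E < g x]) (\1_E x)%:E <=
    ((2 ^+ n * V) * t `^ (- 0))%:E)%E.
  move=> t1; rewrite iE oppr0 powRr0 mulr1.
  apply: (@le_trans _ _ (mu E)).
    by apply: le_measure; rewrite ?inE //; exact: measurableI.
  apply: (le_trans EV); rewrite lee_fin ler_peMl ?(ltW V0) //.
  by rewrite exprn_ege1 // ler1n.
have H2 t : 0 < t -> (\int[mu]_(x in [set x | t%:E < g x]) (\1_E x)%:E <=
    ((2 ^+ n * V) * t `^ (- b))%:E)%E.
  move=> t1; rewrite iE.
  pose rho := (t * t0) `^ alpha^-1.
  have rho0 : 0 < rho by rewrite powR_gt0 // mulr_gt0.
  apply: (@le_trans _ _ ((2 * rho) ^+ n)%:E).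
    rewrite -(lebesgueN_cube [tuple 0 | i < n] (ltW rho0)).
    apply: le_measure; rewrite ?inE; [exact: measurableI|exact: measurable_cube|].
    move=> x [_ /=]; rewrite lte_fin mulrC ltr_pdivlMr // => h i.
    rewrite tnth_mktuple subr0; apply: (le_trans (tnth_le_enorm x i)).
    rewrite leNgt; apply/negP => h2; move: h; apply/negP; rewrite -leNgt.
    have -> : t * t0 = rho `^ alpha.
      by rewrite /rho -powRrM mulVf // powRr1 // mulr_ge0 // ltW.
    have pwN y : y `^ alpha = (y `^ (- alpha))^-1 by rewrite -powRN opprK.
    have x0 : 0 < enorm x by exact: lt_trans h2.
    rewrite !pwN lef_pV2 ?posrE ?powR_gt0 //.
    by rewrite ge0_ler_powR ?nnegrE ?ltW.
    by rewrite mulr_gt0.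
  rewrite lee_fin exprMn -mulrA ler_pM2l ?exprn_gt0 //.
  rewrite /rho -powR_mulrn ?powR_ge0 // -powRrM powRM ?(ltW t1) ?(ltW t00) //.
  rewrite /t0 -powRrM mulrC.
  rewrite (_ : alpha / n%:R * _ = 1); last by field; rewrite (lt_eqF a0) gt_eqF.
  rewrite powRr1 ?(ltW V0) // (_ : alpha^-1 * _ = - b) // /b.
  by field; rewrite (lt_eqF a0).
move=> /(_ H1 H2) H.
have -> : (\int[mu]_(x in E) (enorm x `^ alpha)%:E = t0%:E * \int[mu]_x (g x `^ 1 * (\1_E x)%:E))%E.
  rewrite -ge0_integralZl ?lee_fin ?(ltW t00) //; last 2 first.
  - apply: emeasurable_funM; last exact/measurable_EFinP.
    by under eq_fun do rewrite poweRe1 //.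
  - by move=> x _; rewrite mule_ge0 ?poweR_ge0 // lee_fin ler0n.
  rewrite [LHS]integral_mkcond; apply: eq_integral => x _.
  rewrite poweRe1 // /g /patch indicE -!EFinM.
  case: ifPn => _; last by rewrite !mulr0.
  by rewrite mulr1 mulrA mulfV ?mul1r // gt_eqF.
apply: (@le_trans _ _ (t0%:E * (layer_cake_const 0 b 1 * (2 ^+ n * V))%:E)%E).
  by apply: lee_wpmul2l => //; rewrite lee_fin ltW.
rewrite -EFinM lee_fin powRD ?(gt_eqF V0) ?implybT // powRr1 ?(ltW V0) // -/t0 /C.
by rewrite le_eqVlt; apply/orP; left; apply/eqP; ring.
Qed.

End power_weight.

(** * The Hardy-Littlewood maximal function *)
Section maximal_function.
Context {R : realType} {n : nat}.
Local Notation mu := (@lebesgueN R n).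
Implicit Types (F G : n.-tuple R -> \bar R) (x : n.-tuple R).

Definition rational_cube (j : nat) : n.-tuple rat * rat :=
  odflt ([tuple 0 | i < n], 1) (unpickle j).

Definition rcenter j : n.-tuple R :=
  [tuple ratr (tnth (rational_cube j).1 i) | i < n].

(** Codes with a nonpositive radius stand for the radius 1, so that every index
    names a cube of positive measure. *)
Definition rradius j : R :=
  if 0 < (rational_cube j).2 then ratr (rational_cube j).2 else 1.

Lemma rradius_gt0 j : 0 < rradius j.
Proof. by rewrite /rradius; case: ifP => //; rewrite ltr0q. Qed.

Definition rcube j : set (n.-tuple R) := cube (rcenter j) (rradius j).

(** The centre moves by at most r / 2, and a radius between 3 r / 2 and 2 r makes
    up for it. *)
Lemma rational_cube_approx x (r : R) : 0 < r ->
  exists j, cube x r `<=` rcube j /\ rradius j <= 2 * r.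
Proof.
move=> r0.
have [q] : exists q : rat, ratr q \in `]3 / 2 * r, 2 * r[.
  by apply: rat_in_itvoo; lra.
rewrite in_itv /= => /andP[q1 q2].
have /choice[c hc] : forall i : 'I_n, exists c : rat,
    ratr c \in `]tnth x i - r / 2, tnth x i + r / 2[.
  by move=> i; apply: rat_in_itvoo; lra.
have q0 : 0 < q by rewrite -(ltr0q R); lra.
exists (pickle ([tuple c i | i < n], q)).
have E : rational_cube (pickle ([tuple c i | i < n], q)) = ([tuple c i | i < n], q).
  by rewrite /rational_cube pickleK.
have Er : rradius (pickle ([tuple c i | i < n], q)) = ratr q.
  by rewrite /rradius E /= q0.
split; last by rewrite Er ltW.
move=> y hy i; rewrite Er /rcenter E !tnth_mktuple /=.
have := hy i; have := hc i; rewrite in_itv /= => /andP[c1 c2].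
rewrite !ler_norml => /andP[a1 a2]; apply/andP; split; lra.
Qed.

Definition cube_average F j : \bar R :=
  (((2 * rradius j) ^- n)%:E * \int[mu]_(y in rcube j) F y)%E.

(** The supremum runs over a countable family of cubes, which makes it Borel; the
    cubes that do not contain x contribute 0. *)
Definition HL_maximal F x : \bar R :=
  ereal_sup [set (cube_average F j * (\1_(rcube j) x)%:E)%E | j in [set: nat]].

Lemma cube_average_ge0 F j : (forall y, 0 <= F y)%E -> (0 <= cube_average F j)%E.
Proof.
move=> F0; rewrite mule_ge0 ?integral_ge0 // lee_fin invr_ge0 exprn_ge0 //.
by rewrite mulr_ge0 // ltW // rradius_gt0.
Qed.

Lemma HL_maximal_ge0 F x : (forall y, 0 <= F y)%E -> (0 <= HL_maximal F x)%E.
Proof.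
move=> F0; apply: (@le_trans _ _ (cube_average F 0 * (\1_(rcube 0) x)%:E)%E).
  by rewrite mule_ge0 ?cube_average_ge0 // lee_fin.
by apply: ereal_sup_ubound; exists 0%N.
Qed.

Lemma measurable_HL_maximal F : (forall y, 0 <= F y)%E ->
  measurable_fun setT (HL_maximal F).
Proof.
move=> F0.
rewrite (_ : HL_maximal F = fun x =>
    esups (fun j => cube_average F j * (\1_(rcube j) x)%:E)%E 0); last first.
  apply/funext => x; rewrite /HL_maximal /esups /=; congr ereal_sup.
  by apply/seteqP; split => y [j _ <-]; exists j.
apply: measurable_fun_esups => j.
apply: emeasurable_funM; first exact: measurable_cst.
apply/measurable_EFinP; apply: measurable_indic; exact: measurable_cube.
Qed.

Lemma cube_average_le_maximal F x j : rcube j x ->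
  (cube_average F j <= HL_maximal F x)%E.
Proof.
move=> jx; apply: ereal_sup_ubound; exists j => //.
by rewrite indicE mem_set // mule1.
Qed.

Lemma integral_cube_le_maximal F x (r : R) : (forall y, 0 <= F y)%E ->
  measurable_fun setT F -> 0 < r ->
  (\int[mu]_(y in cube x r) F y <= ((4 * r) ^+ n)%:E * HL_maximal F x)%E.
Proof.
move=> F0 mF r0; have [j [sub rj]] := rational_cube_approx x r0.
have j0 := rradius_gt0 j.
apply: (@le_trans _ _ (\int[mu]_(y in rcube j) F y)%E).
  apply: ge0_subset_integral => //; try exact: measurable_cube.
  exact: measurable_funTS.
have -> : (\int[mu]_(y in rcube j) F y)%E =
    (((2 * rradius j) ^+ n)%:E * cube_average F j)%E.
  rewrite /cube_average muleA -EFinM mulfV ?mul1e //.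
  by rewrite expf_neq0 // gt_eqF // mulr_gt0.
apply: lee_pmul; rewrite ?lee_fin ?cube_average_ge0 ?exprn_ge0 ?mulr_ge0 ?(ltW j0) //.
  by rewrite lerXn2r ?nnegrE ?mulr_ge0 ?(ltW j0) ?(ltW r0) //; lra.
apply: cube_average_le_maximal; apply: sub; exact: cube_center (ltW r0).
Qed.

Lemma HL_maximal_series (c : nat -> R) (F : nat -> n.-tuple R -> \bar R) x :
  (forall k, 0 <= c k) -> (forall k y, 0 <= F k y)%E ->
  (forall k, measurable_fun setT (F k)) ->
  (HL_maximal (fun y => \sum_(0 <= k <oo) (c k)%:E * F k y) x <=
   \sum_(0 <= k <oo) (c k)%:E * HL_maximal (F k) x)%E.
Proof.
move=> c0 F0 mF; apply: ge_ereal_sup => _ [j _ <-].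
have cF0 k y : (0 <= (c k)%:E * F k y)%E by rewrite mule_ge0 // lee_fin.
have s0 : (0 <= \sum_(0 <= k <oo) (c k)%:E * HL_maximal (F k) x)%E.
  by apply: nneseries_ge0 => k _ _; rewrite mule_ge0 ?HL_maximal_ge0 ?lee_fin.
rewrite indicE; case: (boolP (x \in rcube j)); last by rewrite mule0.
rewrite inE mule1 => xj.
rewrite /cube_average integral_nneseries; last 3 first.
- exact: measurable_cube.
- move=> k; apply: measurable_funTS; apply: emeasurable_funM => //.
- by move=> k y _; exact: cF0.
rewrite -nneseriesZl; last by move=> k _; exact: integral_ge0.
apply: lee_nneseries => k _.
  move=> _; rewrite mule_ge0 ?integral_ge0 // lee_fin invr_ge0 exprn_ge0 //.
  by rewrite mulr_ge0 // ltW // rradius_gt0.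
rewrite ge0_integralZl //; last 3 first.
- exact: measurable_cube.
- exact: measurable_funTS.
- by rewrite lee_fin.
rewrite muleCA; apply: lee_wpmul2l; first by rewrite lee_fin.
exact: cube_average_le_maximal.
Qed.

(** The set {M F > t} is the union of the cubes on which the average of F
    exceeds t. *)
Lemma HL_maximal_weak (F phi : n.-tuple R -> \bar R) (t : R) :
  measurable_fun setT phi -> (forall x, 0 <= phi x)%E -> 0 < t ->
  (forall j, (t%:E * mu (rcube j) < \int[mu]_(y in rcube j) F y)%E ->
     (mu (rcube j) <= \int[mu]_(y in rcube j) phi y)%E) ->
  (mu [set x | (t%:E < HL_maximal F x)%E] <= (3 ^+ n)%:E * \int[mu]_x phi x)%E.
Proof.
move=> mphi phi0 t0 H.
pose D := [set j | (t%:E < cube_average F j)%E].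
have -> : [set x | (t%:E < HL_maximal F x)%E] = \bigcup_(j in D) rcube j.
  apply/seteqP; split => x.
    move=> /= /ereal_sup_gt[_ [j _ <-]]; rewrite indicE.
    case: (boolP (x \in rcube j)); last by rewrite mule0 lte_fin ltNge (ltW t0).
    by rewrite inE mule1 => xj tj; exists j.
  move=> [j Dj xj]; apply: (lt_le_trans Dj); exact: cube_average_le_maximal.
apply: countable_covering => //.
  by move=> i; rewrite ltW // rradius_gt0.
move=> j Dj; apply: H.
have j0 := rradius_gt0 j.
rewrite /rcube lebesgueN_cube ?(ltW j0) // muleC -lte_pdivlMl ?exprn_gt0 ?mulr_gt0 //.
Qed.

End maximal_function.

Section young.
Context {R : realType}.

(** Young's inequality for u * 1.  It replaces Hoelder's inequality on sets of
    finite measure throughout. *)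
Lemma le_powR_young (s u : R) : 1 < s -> 0 <= u -> u <= s^-1 * u `^ s + (1 - s^-1).
Proof.
move=> s1 u0; have s0 : 0 < s by lra.
have h : 0 < 1 - s^-1 by rewrite subr_gt0 invf_lt1.
have := @conjugate_powR R u 1 s (1 - s^-1)^-1 u0 ler01.
rewrite invr_gt0 => /(_ s0 h).
rewrite invrK powR1 mulr1 mul1r mulrC => H; apply: H; lra.
Qed.

End young.

Section young_integral.
Context {R : realType} {n : nat}.
Local Notation mu := (@lebesgueN R n).
Implicit Types (F : n.-tuple R -> R) (D : set (n.-tuple R)).

Lemma measurable_powR_comp F (s : R) : measurable_fun setT F ->
  measurable_fun setT (fun x => F x `^ s).
Proof.
move=> mF.
by apply: (@measurableT_comp _ _ _ _ _ _ (fun x : R => x `^ s)); first exact: measurable_powR.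
Qed.

Lemma integral_young F D (s : R) : 1 < s -> measurable_fun setT F ->
  (forall x, 0 <= F x) -> measurable D ->
  (\int[mu]_(x in D) (F x)%:E <=
   (s^-1)%:E * \int[mu]_(x in D) (F x `^ s)%:E + (1 - s^-1)%:E * mu D)%E.
Proof.
move=> s1 mF F0 mD; have s0 : 0 < s^-1 by rewrite invr_gt0; lra.
have mFs := measurable_powR_comp s mF.
have h : 0 <= 1 - s^-1 by rewrite subr_ge0 invf_le1 ?ltW //; lra.
rewrite -(integral_cst mu mD) -ge0_integralZl //; last 3 first.
- by apply/measurable_EFinP; exact: measurable_funTS.
- by move=> x _; rewrite lee_fin powR_ge0.
- by rewrite lee_fin ltW.
rewrite -ge0_integralD //; last 2 first.
- by move=> x _; rewrite -EFinM lee_fin mulr_ge0 ?powR_ge0 // ltW.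
- by apply/measurable_EFinP; apply: measurable_funM => //; exact: measurable_funTS.
apply: le_integral_nonmeasurable => x _; rewrite ?lee_fin //=.
exact: le_powR_young.
Qed.

(** Jensen's inequality at the level 1: if the mean of F exceeds 1, the mean of F^s
    is at least 1. *)
Lemma lt_integral_le_integral_powR F D (s q : R) : 1 < s ->
  measurable_fun setT F -> (forall x, 0 <= F x) -> measurable D ->
  mu D = q%:E -> (q%:E < \int[mu]_(x in D) (F x)%:E)%E ->
  (q%:E <= \int[mu]_(x in D) (F x `^ s)%:E)%E.
Proof.
move=> s1 mF F0 mD Dq h; have s0 : 0 < s^-1 by rewrite invr_gt0; lra.
have := lt_le_trans h (integral_young s1 mF F0 mD).
have : (0 <= \int[mu]_(x in D) (F x `^ s)%:E)%E.
  by apply: integral_ge0 => x _; rewrite lee_fin powR_ge0.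
rewrite Dq; case: (\int[mu]_(x in D) (F x `^ s)%:E)%E => [r| |] //= r0.
  rewrite -!EFinM -EFinD lte_fin lee_fin => h1.
  by rewrite -(ler_pM2l s0); lra.
by rewrite leey.
Qed.

End young_integral.

Section block_maximal.
Context {R : realType} {n : nat}.
Local Notation mu := (@lebesgueN R n).
Variables (s V : R) (B : set (n.-tuple R)) (F : n.-tuple R -> R).
Hypotheses (s1 : 1 < s) (mF : measurable_fun setT F) (F0 : forall x, 0 <= F x).

(** On a cube where the average of F exceeds t, the average of (F / t)^e is at
    least 1; the covering lemma applies to this function. *)
Let HL_maximal_weak_powR (t e I : R) : 0 < t -> 1 <= e ->
  (\int[mu]_x (F x `^ e)%:E <= I%:E)%E ->
  (mu [set x | (t%:E < HL_maximal (fun y => (F y)%:E) x)%E] <=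
   (3 ^+ n * I * t `^ (- e))%:E)%E.
Proof.
move=> t0 e1 FI; have te0 : 0 <= t `^ (- e) by rewrite powR_ge0.
have mFe := measurable_powR_comp e mF.
pose G (x : n.-tuple R) := t^-1 * F x.
have mG : measurable_fun setT G by apply: measurable_funM.
have G0 x : 0 <= G x by rewrite mulr_ge0 // invr_ge0 ltW.
have GE x : G x `^ e = t `^ (- e) * F x `^ e.
  rewrite powRM // ?invr_ge0 ?(ltW t0) //; congr (_ * _).
  by rewrite powRN -powR_inv1 ?(ltW t0) // -powRrM mulN1r powRN.
pose phi (x : n.-tuple R) := (G x `^ e)%:E.
have mphi : measurable_fun setT phi.
  apply/measurable_EFinP; exact: measurable_powR_comp.
have phi0 x : (0 <= phi x)%E by rewrite lee_fin powR_ge0.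
apply: (le_trans (HL_maximal_weak (phi := phi) mphi phi0 t0 _)); last first.
  rewrite /phi; under eq_integral do rewrite GE EFinM.
  rewrite ge0_integralZl ?lee_fin //; last 2 first.
  - by apply/measurable_EFinP.
  - by move=> x _; rewrite lee_fin powR_ge0.
  rewrite -mulrA EFinM; apply: lee_wpmul2l; first by rewrite lee_fin exprn_ge0.
  by rewrite [I * _]mulrC EFinM; apply: lee_wpmul2l => //; rewrite lee_fin.
move=> j hj; have j0 := rradius_gt0 (R := R) (n := n) j.
have E := lebesgueN_cube (rcenter (R := R) (n := n) j) (ltW j0).
have hG : (((2 * rradius (R := R) (n := n) j) ^+ n)%:E < \int[mu]_(y in rcube j) (G y)%:E)%E.
  rewrite /G; under eq_integral do rewrite EFinM.
  rewrite ge0_integralZl ?lee_fin ?invr_ge0 ?(ltW t0) //; last 2 first.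
  - by apply/measurable_EFinP; exact: measurable_funTS.
  - by move=> x _; rewrite lee_fin.
  - by rewrite lte_pdivlMl // -E.
  - exact: measurable_cube.
rewrite [leLHS]E.
move: e1; rewrite le_eqVlt => /orP[/eqP e1|e1].
  apply: (le_trans (ltW hG)); apply: le_integral_nonmeasurable => x _.
    by rewrite lee_fin.
  by rewrite /phi -e1 powRr1.
apply: lt_integral_le_integral_powR => //; exact: measurable_cube.
Qed.

Hypotheses (mB : measurable B) (FB : forall x, ~ B x -> F x = 0).
Hypotheses (V0 : 0 < V) (BV : (mu B <= V%:E)%E).
Hypothesis FsV : (\int[mu]_x (F x `^ s)%:E <= V%:E)%E.

Lemma HL_maximal_weak_s (t : R) : 0 < t ->
  (mu [set x | (t%:E < HL_maximal (fun y => (F y)%:E) x)%E] <=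
   (3 ^+ n * V * t `^ (- s))%:E)%E.
Proof. by move=> t0; apply: HL_maximal_weak_powR => //; exact: ltW. Qed.

Lemma HL_maximal_weak_1 (t : R) : 0 < t ->
  (mu [set x | (t%:E < HL_maximal (fun y => (F y)%:E) x)%E] <=
   (3 ^+ n * V * t `^ (- 1))%:E)%E.
Proof.
move=> t0; apply: HL_maximal_weak_powR => //.
have sp : 0 < s by exact: lt_trans s1.
have s0 : 0 < s^-1 by rewrite invr_gt0.
have h : 0 <= 1 - s^-1 by rewrite subr_ge0 invf_le1 // ltW.
have -> : (\int[mu]_x (F x `^ 1)%:E = \int[mu]_(x in B) (F x)%:E)%E.
  rewrite [RHS]integral_mkcond; apply: eq_integral => x _.
  rewrite powRr1 // /patch; case: ifPn => // /negP xB.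
  by rewrite FB // => Bx; apply: xB; rewrite inE.
apply: (le_trans (integral_young s1 mF F0 mB)).
have -> : (V%:E = (s^-1)%:E * V%:E + (1 - s^-1)%:E * V%:E)%E.
  by rewrite -!EFinM -EFinD; congr EFin; ring.
apply: leeD; apply: lee_wpmul2l; rewrite ?lee_fin ?(ltW s0) //.
apply: le_trans FsV; apply: ge0_subset_integral => //.
- by apply/measurable_EFinP; exact: measurable_powR_comp.
- by move=> x _; rewrite lee_fin powR_ge0.
Qed.

End block_maximal.

Section weighted_maximal.
Context {R : realType} {n : nat}.
Local Notation mu := (@lebesgueN R n).

(** With th = 1 + alpha / n, the weak bounds at 1 and s for Lebesgue measure
    become weak bounds at th and s th for the weight, and th < p < s th
    restates the bounds on alpha. *)
Lemma weighted_maximal_le (s p alpha : R) : (0 < n)%N -> 1 < s -> 0 < p ->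
  n%:R * (p / s - 1) < alpha -> alpha < n%:R * (p - 1) -> alpha <= 0 ->
  exists2 C : R, 0 < C & forall (V : R) (B : set (n.-tuple R)) (F : n.-tuple R -> R),
    measurable_fun setT F -> (forall x, 0 <= F x) -> measurable B ->
    (forall x, ~ B x -> F x = 0) -> 0 < V -> (mu B <= V%:E)%E ->
    (\int[mu]_x (F x `^ s)%:E <= V%:E)%E ->
    (\int[mu]_x (HL_maximal (fun y => (F y)%:E) x `^ p * (enorm x `^ alpha)%:E)
     <= (C * V `^ (1 + alpha / n%:R))%:E)%E.
Proof.
move=> n0 s1 p0 a1 a2 a0.
have nR : 0 < n%:R :> R by rewrite ltr0n.
have s0 : 0 < s by lra.
have an : - n%:R < alpha.
  apply: lt_trans a1; rewrite mulrBr mulr1 ltrDr mulr_gt0 // divr_gt0 //.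
have [C1 C10 HC] := weight_measure_le n0 an a0.
pose th := 1 + alpha / n%:R.
have th0 : 0 < th.
  rewrite /th -(ltr_pM2l nR) mulr0 mulrDr mulr1 mulrC divfK ?gt_eqF //; lra.
have h1 : th < p.
  rewrite /th -ltrBrDl ltr_pdivrMr //; lra.
have h2 : p < s * th.
  rewrite mulrC -ltr_pdivrMr // /th -ltrBlDl ltr_pdivlMr //; lra.
pose L := layer_cake_const th (s * th) p.
have L0 : 0 <= L by exact: layer_cake_const_ge0.
pose C2 := L * (C1 * (3 ^+ n) `^ th).
have C20 : 0 <= C2 by rewrite !mulr_ge0 ?powR_ge0.
exists (C2 + 1); first by lra.
move=> V B F mF F0 mB FB V0 BV FsV.
set M := HL_maximal _.
have M0 x : (0 <= M x)%E by apply: HL_maximal_ge0 => y; rewrite lee_fin.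
have mM : measurable_fun setT M by apply: measurable_HL_maximal => y; rewrite lee_fin.
have mL t : measurable [set x | (t%:E < M x)%E].
  by rewrite -[X in measurable X]setTI; apply: emeasurable_fun_o_infty.
have key e t : 0 < t ->
    (mu [set x | (t%:E < M x)%E] <= (3 ^+ n * V * t `^ (- e))%:E)%E ->
    (\int[mu]_(x in [set x | t%:E < M x]) (enorm x `^ alpha)%:E <=
       (C1 * (3 ^+ n * V) `^ th * t `^ (- (e * th)))%:E)%E.
  move=> t0 hm; have W0 : 0 < 3 ^+ n * V * t `^ (- e).
    by rewrite !mulr_gt0 ?exprn_gt0 ?powR_gt0.
  apply: (le_trans (HC _ _ (mL t) W0 hm)).
  rewrite lee_fin -/th powRM ?powR_ge0 ?mulr_ge0 ?exprn_ge0 ?(ltW V0) //.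
  by rewrite -powRrM mulNr mulrA.
have N0 : 0 <= C1 * (3 ^+ n * V) `^ th by rewrite mulr_ge0 ?powR_ge0.
apply: (le_trans (layer_cake_le p0 h1 h2 N0 mM M0 (measurable_weight alpha)
  (fun x => powR_ge0 _ _) _ _)).
- move=> t t0; rewrite -[X in - X]mul1r; apply: (key 1) => //.
  exact: (HL_maximal_weak_1 s1 mF F0 mB FB BV FsV).
- move=> t t0; apply: key => //.
  exact: (HL_maximal_weak_s s1 mF F0 FsV).
rewrite lee_fin -/L -/th powRM ?exprn_ge0 ?(ltW V0) // mulrA mulrA.
rewrite -[_ * C1 * _]mulrA -/C2 mulrDl mul1r lerDl powR_ge0 //.
Qed.

End weighted_maximal.

(** * Calculus in one variable *)
Section one_variable_calculus.
Context {R : realType}.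
Implicit Types (f g : R -> R) (x a b k r : R).

Lemma is_derive_add f g x a b : is_derive x 1 f a -> is_derive x 1 g b ->
  is_derive x 1 (fun t => f t + g t) (a + b).
Proof. exact: is_deriveD. Qed.

Lemma is_derive_mul f g x a b : is_derive x 1 f a -> is_derive x 1 g b ->
  is_derive x 1 (fun t => f t * g t) (a * g x + f x * b).
Proof.
move=> fa gb; apply: (is_derive_eq (is_deriveM fa gb)).
by rewrite addrC [g x *: a]mulrC.
Qed.

Lemma is_derive_comp f g x a b : is_derive (g x) 1 f a -> is_derive x 1 g b ->
  is_derive x 1 (fun t => f (g t)) (a * b).
Proof. exact: is_derive1_comp. Qed.

Lemma is_derive_affine x a b : is_derive x 1 (fun t => a + b * t) b.
Proof.
have h := is_derive_add (is_derive_cst a x 1)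
  (is_derive_mul (is_derive_cst b x 1) (is_derive_id x 1)).
by apply: (is_derive_eq h); rewrite mul0r !add0r mulr1.
Qed.

(** Unlike the power function, it vanishes on the negative axis and at 0, also
    for k = 0. *)
Definition pospow k (r : R) : R := if 0 < r then r `^ k else 0.

Lemma pospow_ge0 k r : 0 <= pospow k r.
Proof. by rewrite /pospow; case: ifP => // _; exact: powR_ge0. Qed.

Lemma pospow_le1 k r : 0 <= k -> r <= 1 -> pospow k r <= 1.
Proof.
move=> k0 r1; rewrite /pospow; case: ifP => // r0.
have -> : 1 = 1 `^ k :> R by rewrite powR1.
by rewrite ge0_ler_powR ?nnegrE // ltW.
Qed.

Lemma pospow_eq0 k r : r <= 0 -> pospow k r = 0.
Proof. by rewrite /pospow; case: ltP. Qed.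

Lemma pospowM k r : pospow (k + 1) r = r * pospow k r.
Proof.
rewrite /pospow; case: ltP => [r0|]; last by rewrite mulr0.
by rewrite powRD ?(gt_eqF r0) ?implybT // powRr1 ?(ltW r0) // mulrC.
Qed.

Lemma measurable_pospow k : measurable_fun setT (pospow k).
Proof.
apply: measurable_fun_ifT; [|exact: measurable_powR|exact: measurable_cst].
by apply: measurable_fun_ltr; [exact: measurable_cst|exact: measurable_id].
Qed.

Lemma is_derive_pospow k r : 0 < k ->
  is_derive r 1 (pospow (k + 1)) ((k + 1) * pospow k r).
Proof.
move=> k0; case: (ltgtP r 0) => r0.
- rewrite {2}/pospow ltNge (ltW r0) /= mulr0.
  apply: (@near_eq_is_derive _ _ _ (cst 0)) => //.
    near=> z; rewrite pospow_eq0 //.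
    by apply/ltW; near: z; exact: lt_nbhsl.
- rewrite {2}/pospow r0 /=.
  apply: (@near_eq_is_derive _ _ _ (fun z : R => z `^ (k + 1))).
    near=> z; rewrite /pospow ifT //.
    by near: z; exact: lt_nbhsr.
  by apply: (is_derive_eq (is_derive1_powR (k + 1) r0)); rewrite addrK.
- rewrite r0; apply/is_derive1_caratheodory; exists (pospow k); split.
  (* At 0 the slope function of pospow (k + 1) is pospow k, which is continuous
     there and vanishes. *)
  + by move=> z; rewrite pospowM [pospow _ 0]pospow_eq0 // !subr0 mulrC.
  + apply/cvgrPdist_lt => e e0; near=> z.
    rewrite (pospow_eq0 k (lexx 0)) sub0r normrN ger0_norm ?pospow_ge0 // /pospow.
    case: ifPn => // z0.
    have -> : e = (e `^ k^-1) `^ k.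
      by rewrite -powRrM mulVf ?gt_eqF // powRr1 // ltW.
    rewrite gt0_ltr_powR ?nnegrE ?powR_ge0 ?(ltW z0) //.
    by near: z; apply: lt_nbhsl; rewrite powR_gt0.
  + by rewrite pospow_eq0 // mulr0.
Unshelve. all: by end_near. Qed.

End one_variable_calculus.

(** * Differentiation under the integral sign *)
Section derivative_under_integral.
Context {R : realType} {n : nat}.
Local Notation mu := (@lebesgueN R n).

Lemma integrable_bounded_cube (f : n.-tuple R -> R) c (r M : R) : 0 <= r ->
  measurable_fun setT f -> (forall y, `|f y| <= M * \1_(cube c r) y) ->
  mu.-integrable setT (EFin \o f).
Proof.
move=> r0 mf fM; apply/integrableP; split; first exact/measurable_EFinP.
have M0 : 0 <= M.
  by have := fM c; rewrite indicE mem_set ?mulr1; [apply: le_trans|exact: cube_center].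
apply: (@le_lt_trans _ _ (\int[mu]_y (M * \1_(cube c r) y)%:E)%E).
  by apply: le_integral_nonmeasurable => y _ //=; rewrite lee_fin.
under eq_integral do rewrite EFinM.
rewrite ge0_integralZl //; last first.
  by apply/measurable_EFinP; apply: measurable_indic; exact: measurable_cube.
rewrite integral_indic //; last exact: measurable_cube.
by rewrite setIT lebesgueN_cube // -EFinM ltry.
Qed.

(** Multiples of the indicator of a fixed cube are the only dominating functions
    that compactly supported integrands call for. *)
Lemma is_derive_under_integral (f df : R -> n.-tuple R -> R) a c (r M : R) :
  0 <= r ->
  (forall t, measurable_fun setT (f t)) ->
  (forall t y, `|t - a| < 1 -> `|f t y| <= M * \1_(cube c r) y) ->
  (forall t y, `|t - a| < 1 -> is_derive t 1 (f ^~ y) (df t y)) ->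
  (forall t y, `|t - a| < 1 -> `|df t y| <= M * \1_(cube c r) y) ->
  is_derive a 1 (fun t => \int[mu]_y f t y) (\int[mu]_y df a y).
Proof.
move=> r0 mf fM dfE dfM.
have M0 : 0 <= M.
  have := fM a c; rewrite subrr normr0 ltr01 => /(_ isT).
  by rewrite indicE mem_set ?mulr1; [apply: le_trans|exact: cube_center].
have I t : (`]a - 1, a + 1[ : set R)%classic t -> `|t - a| < 1.
  by rewrite /= in_itv /= ltr_distl.
have Ia : (`]a - 1, a + 1[ : set R)%classic a.
  by rewrite /= in_itv /= ltrBlDr ltrDl ltr01.
have d1 t y : `|t - a| < 1 -> partial1of2 f t y = df t y.
  by move=> ta; rewrite partial1of2E; have [_ ->] := dfE _ y ta.
pose G (y : n.-tuple R) := M * \1_(cube c r) y.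
have mG : measurable_fun setT G.
  apply: measurable_funM => //; apply: measurable_indic; exact: measurable_cube.
have G0 y : 0 <= G y by rewrite mulr_ge0.
have iG : mu.-integrable setT (EFin \o G).
  by apply: (@integrable_bounded_cube _ c r M) => // y; rewrite ger0_norm.
have if_ t : (`]a - 1, a + 1[ : set R)%classic t -> mu.-integrable setT (EFin \o f t).
  by move=> /I ta; apply: (@integrable_bounded_cube _ c r M) => // y; exact: fM.
have derf t y : (`]a - 1, a + 1[ : set R)%classic t -> setT y -> derivable (f ^~ y) t 1.
  by move=> /I ta _; have [] := dfE _ y ta.
have dG t y : (`]a - 1, a + 1[ : set R)%classic t -> setT y -> `|partial1of2 f t y| <= G y.
  by move=> /I ta _; rewrite d1 //; exact: dfM.
apply: DeriveDef.
  exact: (derivable_under_integral measurableT Ia if_ derf G0 iG dG).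
rewrite -derive1E (differentiation_under_integral measurableT Ia if_ derf G0 iG dG).
by apply: eq_Rintegral => y _; rewrite d1 // subrr normr0.
Qed.

End derivative_under_integral.

(** * Directional derivatives integrate to zero *)
Section trig_pairs.
Context {R : realType}.

(** The real and the imaginary part of the kernel, built on cos and on sin, obey
    the same equation; what its proof uses of the pair (cos, sin) is recorded
    here. *)
Record trig_pair (C S : R -> R) : Prop := TrigPair {
  tp_dC : forall x : R, is_derive x 1 C (- S x);
  tp_dS : forall x : R, is_derive x 1 S (C x);
  tp_bC : forall x, `|C x| <= 1;
  tp_bS : forall x, `|S x| <= 1;
  tp_mC : measurable_fun setT C;
  tp_mS : measurable_fun setT S }.

Lemma trig_pair_cos_sin : trig_pair cos sin.
Proof.
split.
- exact: is_derive_cos.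
- exact: is_derive_sin.
- by move=> x; rewrite ler_norml cos_geN1 cos_le1.
- by move=> x; rewrite ler_norml sin_geN1 sin_le1.
- by apply: continuous_measurable_fun; exact: continuous_cos.
- by apply: continuous_measurable_fun; exact: continuous_sin.
Qed.

(** The quarter turn makes the second function of a pair the first one of
    another: this treats the sine like the cosine. *)
Lemma trig_pair_quarter (C S : R -> R) :
  trig_pair C S -> trig_pair S (fun x => - C x).
Proof.
move=> [dC dS bC bS mC mS]; split => //.
- by move=> x; rewrite opprK.
- move=> x; apply: (is_derive_eq (is_deriveN (dC x))); exact: opprK.
- by move=> x; rewrite normrN.
- exact: measurable_funN.
Qed.

End trig_pairs.

Section integration_by_parts.
Context {R : realType} {n : nat}.
Local Notation mu := (@lebesgueN R n).
Implicit Types (u v w x y : n.-tuple R).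

Lemma dot_tupleC u v : dot_tuple u v = dot_tuple v u.
Proof. by apply: eq_bigr => i _; rewrite mulrC. Qed.

Lemma dot_tupleE x : dot_tuple x x = enorm x ^+ 2.
Proof. by rewrite enormE; apply: eq_bigr => i _; rewrite expr2. Qed.

Definition norm1 v : R := \sum_(i < n) `|tnth v i|.

Lemma norm1_ge0 v : 0 <= norm1 v.
Proof. exact: sumr_ge0. Qed.

Lemma tnth_le_norm1 v i : `|tnth v i| <= norm1 v.
Proof. by rewrite /norm1 (bigD1 i) //= lerDl sumr_ge0. Qed.

Lemma dot_le_norm1 u x : (forall i, `|tnth x i| <= 1) ->
  `|dot_tuple u x| <= norm1 u.
Proof.
move=> x1; apply: (le_trans (ler_norm_sum _ _ _)); apply: ler_sum => i _.
by rewrite normrM ler_piMr.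
Qed.

Definition translate v h x : n.-tuple R :=
  affine_tuple 1 [tuple h * tnth v i | i < n] x.

Lemma tnth_translate v h x i : tnth (translate v h x) i = tnth x i + h * tnth v i.
Proof. by rewrite !tnth_mktuple mul1r. Qed.

Lemma translate0 v x : translate v 0 x = x.
Proof. by apply: eq_from_tnth => i; rewrite tnth_translate mul0r addr0. Qed.

Lemma dot_translate u v h x :
  dot_tuple u (translate v h x) = dot_tuple u x + dot_tuple u v * h.
Proof.
rewrite /dot_tuple mulr_suml -big_split /=; apply: eq_bigr => i _.
by rewrite tnth_translate; ring.
Qed.

Lemma measurable_translate v h : measurable_fun setT (translate v h).
Proof. exact: measurable_affine_tuple. Qed.

Definition bump (k : R) x : R := pospow k (1 - enorm x ^+ 2).

Lemma measurable_bump k : measurable_fun setT (bump k).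
Proof.
apply: (@measurableT_comp _ _ _ _ _ _ (pospow k)); first exact: measurable_pospow.
apply: measurable_funB; first exact: measurable_cst.
apply: measurable_funX; exact: measurable_enorm.
Qed.

Lemma bumpS k x : bump (k + 1) x = (1 - enorm x ^+ 2) * bump k x.
Proof. exact: pospowM. Qed.

Lemma bump_ge0 k x : 0 <= bump k x.
Proof. exact: pospow_ge0. Qed.

Lemma bump_le k x : 0 <= k -> bump k x <= \1_(cube [tuple 0 | i < n] 1) x.
Proof.
move=> k0; rewrite /bump; case: (ltP 0 (1 - enorm x ^+ 2)) => h; last first.
  by rewrite pospow_eq0.
rewrite indicE mem_set; last first.
  move=> i; rewrite tnth_mktuple subr0; apply: (le_trans (tnth_le_enorm x i)).
  rewrite leNgt; apply/negP => h1; move: h; apply/negP; rewrite -leNgt subr_le0.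
  by rewrite exprn_ege1 // ltW.
by apply: pospow_le1 => //; rewrite gerBl sqr_ge0.
Qed.

(** The bump is at most 1 and is supported in the unit ball, so that only the size
    of A on the unit cube matters. *)
Lemma norm_mul_bump_le k (A M : R) x : 0 <= k ->
  ((forall i, `|tnth x i| <= 1) -> `|A| <= M) ->
  `|A * bump k x| <= M * \1_(cube [tuple 0 | i < n] 1) x.
Proof.
move=> k0 AM; have b := bump_le x k0.
rewrite normrM (ger0_norm (bump_ge0 _ _)).
move: b; rewrite indicE; case: (boolP (x \in _)) => [|_ b].
  rewrite inE => xc b; apply: ler_pM => //; first exact: bump_ge0.
  by apply: AM => i; have := xc i; rewrite tnth_mktuple subr0.
have -> : bump k x = 0 by apply/eqP; rewrite eq_le b bump_ge0.
by rewrite !mulr0.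
Qed.

Definition unit_cube : set (n.-tuple R) := cube [tuple 0 | i < n] 1.

Lemma translate_unit_cube v h x : `|h| <= 1 ->
  \1_unit_cube (translate v h x) <= \1_(cube [tuple 0 | i < n] (1 + norm1 v)) x :> R.
Proof.
move=> h1; rewrite !indicE ler_nat; case: (boolP (_ \in unit_cube)) => //.
rewrite inE => hx; rewrite mem_set // => i.
have := hx i; rewrite tnth_translate !tnth_mktuple !subr0 => h2.
have h3 : `|h * tnth v i| <= norm1 v.
  by rewrite normrM; apply: le_trans (tnth_le_norm1 v i); rewrite ler_piMl.
rewrite -[tnth x i](addrK (h * tnth v i)).
by apply: (le_trans (ler_normB _ _)); rewrite lerD.
Qed.

Variables (C S : R -> R) (CS : trig_pair C S) (k : R) (k0 : 0 < k).
Variables (t c0 : R) (u w : n.-tuple R).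

(** An affine form times a plane wave times the bump.  The exponent k + 1 > 1 makes
    it continuously differentiable across the unit sphere. *)
Definition test_fun x : R :=
  (c0 + dot_tuple u x) * C (t * dot_tuple w x) * bump (k + 1) x.

(** The derivative of [test_fun] in the direction v. *)
Definition dtest_fun v x : R :=
  dot_tuple u v * C (t * dot_tuple w x) * bump (k + 1) x
  + (c0 + dot_tuple u x) * (- S (t * dot_tuple w x) * (t * dot_tuple w v))
    * bump (k + 1) x
  + (c0 + dot_tuple u x) * C (t * dot_tuple w x)
    * ((k + 1) * (- (2 * dot_tuple v x))) * bump k x.

Lemma measurable_affine_form : measurable_fun setT (fun x => c0 + dot_tuple u x).
Proof. by apply: measurable_funD => //; exact: measurable_dot_tuple. Qed.

Lemma measurable_phase (F : R -> R) : measurable_fun setT F ->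
  measurable_fun setT (fun x : n.-tuple R => F (t * dot_tuple w x)).
Proof.
move=> mF; apply: (@measurableT_comp _ _ _ _ _ _ F) => //.
by apply: measurable_funM => //; exact: measurable_dot_tuple.
Qed.

Lemma measurable_test_fun : measurable_fun setT test_fun.
Proof.
apply: measurable_funM; last exact: measurable_bump.
apply: measurable_funM; first exact: measurable_affine_form.
exact: measurable_phase (tp_mC CS).
Qed.

Lemma measurable_dtest_fun v : measurable_fun setT (dtest_fun v).
Proof.
have mC := measurable_phase (tp_mC CS); have mS := measurable_phase (tp_mS CS).
have mb := @measurable_bump; have ma := measurable_affine_form.
apply: measurable_funD; [apply: measurable_funD|].
- by apply: measurable_funM => //; apply: measurable_funM.
- apply: measurable_funM => //; apply: measurable_funM => //.
  by apply: measurable_funM => //; exact: measurable_funN.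
- apply: measurable_funM => //; apply: measurable_funM; first exact: measurable_funM.
  apply: measurable_funM => //; apply: measurable_funN.
  by apply: measurable_funM => //; exact: measurable_dot_tuple.
Qed.

Let A := `|c0| + norm1 u.

Lemma affine_form_le x : (forall i, `|tnth x i| <= 1) ->
  `|c0 + dot_tuple u x| <= A.
Proof.
by move=> x1; apply: (le_trans (ler_normD _ _)); rewrite lerD ?dot_le_norm1.
Qed.

Lemma test_fun_le x : `|test_fun x| <= A * \1_unit_cube x.
Proof.
apply: norm_mul_bump_le; first by rewrite addr_ge0 // ltW.
move=> x1; rewrite normrM -[leRHS]mulr1; apply: ler_pM => //.
  exact: affine_form_le.
exact: tp_bC CS _.
Qed.

Definition dtest_fun_bound v : R :=
  `|dot_tuple u v| + A * `|t * dot_tuple w v| + A * ((k + 1) * (2 * norm1 v)).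

Lemma dtest_fun_le v x : `|dtest_fun v x| <= dtest_fun_bound v * \1_unit_cube x.
Proof.
have k1 : 0 <= k + 1 by rewrite addr_ge0 // ltW.
apply: (le_trans (ler_normD _ _)); rewrite /dtest_fun_bound [leRHS]mulrDl; apply: lerD.
  apply: (le_trans (ler_normD _ _)); rewrite [leRHS]mulrDl; apply: lerD.
    apply: norm_mul_bump_le => // x1; rewrite normrM -[leRHS]mulr1.
    by apply: ler_pM => //; exact: tp_bC CS _.
  apply: norm_mul_bump_le => // x1; rewrite normrM; apply: ler_pM => //.
    exact: affine_form_le.
  by rewrite normrM normrN -[leRHS]mul1r; apply: ler_pM => //; exact: tp_bS CS _.
apply: norm_mul_bump_le => //; first exact: ltW.
move=> x1; rewrite normrM; apply: ler_pM => //.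
  rewrite normrM -[leRHS]mulr1; apply: ler_pM => //; first exact: affine_form_le.
  exact: tp_bC CS _.
rewrite normrM normrN normrM (ger0_norm k1) (ger0_norm (ler0n _ 2)).
by apply: ler_wpM2l => //; apply: ler_wpM2l => //; exact: dot_le_norm1.
Qed.

Lemma is_derive_bump_translate v x (h : R) :
  is_derive h 1 (fun h => bump (k + 1) (translate v h x))
    ((k + 1) * bump k (translate v h x) * (- (2 * dot_tuple v (translate v h x)))).
Proof.
rewrite /bump.
have dn : is_derive h 1 (fun h => 1 - enorm (translate v h x) ^+ 2)
    (- (2 * dot_tuple v (translate v h x))).
  have -> : (fun h => 1 - enorm (translate v h x) ^+ 2) =
      (fun h => (1 - enorm x ^+ 2) + (- 1) * (h * (2 * dot_tuple v x + enorm v ^+ 2 * h))).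
    apply/funext => h'; rewrite -!dot_tupleE dot_translate [dot_tuple _ x]dot_tupleC.
    by rewrite [dot_tuple _ v]dot_tupleC !dot_translate [dot_tuple x v]dot_tupleC; ring.
  have h1 := is_derive_mul (is_derive_id h 1)
    (is_derive_affine h (2 * dot_tuple v x) (enorm v ^+ 2)).
  have h2 := is_derive_add (is_derive_cst (1 - enorm x ^+ 2) h 1)
    (is_derive_mul (is_derive_cst (-1 : R) h 1) h1).
  apply: (is_derive_eq h2); rewrite dot_translate dot_tupleE /=; ring.
exact: (is_derive_comp (is_derive_pospow _ k0) dn).
Qed.

Lemma is_derive_test_fun_translate v x (h : R) :
  is_derive h 1 (fun h => test_fun (translate v h x)) (dtest_fun v (translate v h x)).
Proof.
have da : is_derive h 1 (fun h => c0 + dot_tuple u (translate v h x)) (dot_tuple u v).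
  have -> : (fun h => c0 + dot_tuple u (translate v h x)) =
     (fun h => (c0 + dot_tuple u x) + dot_tuple u v * h).
    by apply/funext => h'; rewrite dot_translate addrA.
  exact: is_derive_affine.
have dp : is_derive h 1 (fun h => t * dot_tuple w (translate v h x)) (t * dot_tuple w v).
  have -> : (fun h => t * dot_tuple w (translate v h x)) =
     (fun h => t * dot_tuple w x + (t * dot_tuple w v) * h).
    by apply/funext => h'; rewrite dot_translate; ring.
  exact: is_derive_affine.
have dC := is_derive_comp (tp_dC CS _) dp.
have := is_derive_mul (is_derive_mul da dC) (is_derive_bump_translate v x h).
move=> /is_derive_eq; apply; rewrite /dtest_fun; ring.
Qed.

(** By translation invariance, the integral of x |-> test_fun (x + h v) does not
    depend on h; its derivative at h = 0 is the integral of [dtest_fun]. *)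
Lemma integral_dtest_fun v : \int[mu]_x dtest_fun v x = 0.
Proof.
pose r := 1 + norm1 v.
have r0 : 0 <= r by rewrite addr_ge0 ?norm1_ge0.
have A0 : 0 <= A by rewrite addr_ge0 ?norm1_ge0.
have D0 : 0 <= dtest_fun_bound v.
  have k1 : 0 <= k + 1 by rewrite addr_ge0 // ltW.
  by rewrite !addr_ge0 ?mulr_ge0 ?norm1_ge0.
have H : is_derive (0 : R) 1 (fun h => \int[mu]_x test_fun (translate v h x))
    (\int[mu]_x dtest_fun v (translate v 0 x)).
  apply: (@is_derive_under_integral _ _ (fun h x => test_fun (translate v h x))
    (fun h x => dtest_fun v (translate v h x)) _ [tuple 0 | i < n] r (A + dtest_fun_bound v)) => //.
  - move=> h; apply: (@measurableT_comp _ _ _ _ _ _ test_fun).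
      exact: measurable_test_fun.
    exact: measurable_translate.
  - move=> h x; rewrite subr0 => h1; apply: (le_trans (test_fun_le _)).
    by apply: ler_pM => //; [rewrite lerDl|exact/translate_unit_cube/ltW].
  - by move=> h x _; exact: is_derive_test_fun_translate.
  - move=> h x; rewrite subr0 => h1; apply: (le_trans (dtest_fun_le _ _)).
    by apply: ler_pM => //; [rewrite lerDr|exact/translate_unit_cube/ltW].
have E : (fun h => \int[mu]_x test_fun (translate v h x)) = cst (\int[mu]_x test_fun x).
  apply/funext => h; rewrite /translate Rintegral_affine //; last exact: measurable_test_fun.
  by rewrite expr1n invr1 mul1r.
rewrite E in H; have [_ H1] := H; have [_ H2] := is_derive_cst (\int[mu]_x test_fun x) (0 : R) 1.
transitivity (\int[mu]_x dtest_fun v (translate v 0 x)).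
  by apply: eq_Rintegral => x _; rewrite translate0.
by rewrite -H1 H2.
Qed.

Lemma integrable_dtest_fun v : mu.-integrable setT (EFin \o dtest_fun v).
Proof.
apply: (@integrable_bounded_cube _ _ _ [tuple 0 | i < n] 1 (dtest_fun_bound v)) => //.
  exact: measurable_dtest_fun.
exact: dtest_fun_le.
Qed.

End integration_by_parts.

(** * The radial equation of the kernel *)
Section has_integral.
Context {R : realType} {n : nat}.
Local Notation mu := (@lebesgueN R n).
Implicit Types (f g : n.-tuple R -> R) (a b : R).

Definition has_int f a : Prop :=
  mu.-integrable setT (EFin \o f) /\ \int[mu]_x f x = a.

Lemma has_int_eq f g a b : has_int f a -> f =1 g -> a = b -> has_int g b.
Proof. by move=> fa /funext <- <-. Qed.

Lemma has_intD f g a b : has_int f a -> has_int g b ->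
  has_int (fun x => f x + g x) (a + b).
Proof.
move=> [fi fa] [gi gb]; split; last by rewrite RintegralD // fa gb.
rewrite (_ : EFin \o _ = (EFin \o f) \+ (EFin \o g))%E; last exact/funext.
exact: integrableD.
Qed.

Lemma has_intZ f a k : has_int f a -> has_int (fun x => k * f x) (k * a).
Proof.
move=> [fi fa]; split; last by rewrite RintegralZl // fa.
rewrite (_ : EFin \o _ = (fun x => k%:E * (EFin \o f) x)%E); last exact/funext.
exact: integrableZl.
Qed.

Lemma has_int0 : has_int (fun _ => 0) 0.
Proof.
split; first exact: integrable0.
by rewrite /Rintegral integral0.
Qed.

Lemma has_int_sum0 (F : 'I_n -> n.-tuple R -> R) : (forall i, has_int (F i) 0) ->
  has_int (fun x => \sum_(i < n) F i x) 0.
Proof.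
move=> HF.
suff H (r : seq 'I_n) : has_int (fun x => \sum_(i <- r) F i x) 0 by exact: H.
elim: r => [|i r IH].
  by apply: (has_int_eq has_int0) => // x; rewrite big_nil.
apply: (has_int_eq (has_intD (HF i) IH)); last by rewrite addr0.
by move=> x; rewrite big_cons.
Qed.

End has_integral.

Section radial_ode.
Context {R : realType} {n : nat}.
Local Notation mu := (@lebesgueN R n).
Variables (C S : R -> R) (CS : trig_pair C S) (k : R) (k0 : 0 < k).
Variables (w : n.-tuple R) (w1 : enorm w = 1).

(** [osc1] and [osc2] are the first two derivatives of [osc0] in t. *)
Definition osc0 t x : R := C (t * dot_tuple w x) * bump k x.
Definition osc1 t x : R := - S (t * dot_tuple w x) * dot_tuple w x * bump k x.
Definition osc2 t x : R :=
  - C (t * dot_tuple w x) * dot_tuple w x ^+ 2 * bump k x.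

Let W := Num.max 1 (norm1 w ^+ 2) + norm1 w.

Let W_ge : [/\ 0 <= W, 1 <= W, norm1 w <= W & norm1 w ^+ 2 <= W].
Proof.
have h := norm1_ge0 w.
have h1 : 1 <= Num.max 1 (norm1 w ^+ 2) by rewrite le_max lexx.
have h2 : norm1 w ^+ 2 <= Num.max 1 (norm1 w ^+ 2) by rewrite le_max lexx orbT.
by rewrite /W; split; lra.
Qed.

Let mdot : measurable_fun setT (dot_tuple w). Proof. exact: measurable_dot_tuple. Qed.

Lemma measurable_osc t : [/\ measurable_fun setT (osc0 t),
  measurable_fun setT (osc1 t) & measurable_fun setT (osc2 t)].
Proof.
have mC := measurable_phase t w (tp_mC CS); have mS := measurable_phase t w (tp_mS CS).
have mb := @measurable_bump R n k.
split.
- exact: measurable_funM.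
- by apply: measurable_funM => //; apply: measurable_funM => //; exact: measurable_funN.
- apply: measurable_funM => //; apply: measurable_funM; first exact: measurable_funN.
  exact: measurable_funX.
Qed.

Lemma osc0_le t x : `|osc0 t x| <= 1 * \1_(cube [tuple 0 | i < n] 1) x.
Proof. by apply: norm_mul_bump_le => [|_]; [exact: ltW|exact: tp_bC CS _]. Qed.

Lemma osc1_le t x : `|osc1 t x| <= norm1 w * \1_(cube [tuple 0 | i < n] 1) x.
Proof.
apply: norm_mul_bump_le => [|x1]; first exact: ltW.
rewrite normrM normrN -[leRHS]mul1r; apply: ler_pM => //; first exact: tp_bS CS _.
exact: dot_le_norm1.
Qed.

Lemma osc2_le t x : `|osc2 t x| <= norm1 w ^+ 2 * \1_(cube [tuple 0 | i < n] 1) x.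
Proof.
apply: norm_mul_bump_le => [|x1]; first exact: ltW.
rewrite normrM normrN -[leRHS]mul1r; apply: ler_pM => //; first exact: tp_bC CS _.
by rewrite normrX lerXn2r ?nnegrE ?norm1_ge0 // dot_le_norm1.
Qed.

Lemma integrable_osc t : [/\ mu.-integrable setT (EFin \o osc0 t),
  mu.-integrable setT (EFin \o osc1 t) & mu.-integrable setT (EFin \o osc2 t)].
Proof.
have [m0 m1 m2] := measurable_osc t; split.
- exact: (integrable_bounded_cube ler01 m0 (osc0_le t)).
- exact: (integrable_bounded_cube ler01 m1 (osc1_le t)).
- exact: (integrable_bounded_cube ler01 m2 (osc2_le t)).
Qed.

Let dphase (t : R) x :
  is_derive t 1 (fun t => t * dot_tuple w x) (dot_tuple w x).
Proof.
have := is_derive_mul (is_derive_id t 1) (is_derive_cst (dot_tuple w x) t 1).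
by move=> /is_derive_eq; apply; rewrite mul1r mulr0 addr0.
Qed.

Lemma is_derive_osc0 (t : R) :
  is_derive t 1 (fun t => \int[mu]_x osc0 t x) (\int[mu]_x osc1 t x).
Proof.
have [W0 W1 W2 W3] := W_ge.
apply: (@is_derive_under_integral _ _ osc0 osc1 _ [tuple 0 | i < n] 1 W) => //.
- by move=> s; have [] := measurable_osc s.
- move=> s x _; apply: (le_trans (osc0_le s x)); exact: ler_wpM2r.
- move=> s x _.
  have := is_derive_mul (is_derive_comp (tp_dC CS _) (dphase s x))
    (is_derive_cst (bump k x) s 1).
  by move=> /is_derive_eq; apply; rewrite mulr0 addr0.
- move=> s x _; apply: (le_trans (osc1_le s x)); exact: ler_wpM2r.
Qed.

Lemma is_derive_osc1 (t : R) :
  is_derive t 1 (fun t => \int[mu]_x osc1 t x) (\int[mu]_x osc2 t x).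
Proof.
have [W0 W1 W2 W3] := W_ge.
apply: (@is_derive_under_integral _ _ osc1 osc2 _ [tuple 0 | i < n] 1 W) => //.
- by move=> s; have [] := measurable_osc s.
- move=> s x _; apply: (le_trans (osc1_le s x)); exact: ler_wpM2r.
- move=> s x _.
  have := is_derive_mul (is_derive_mul (is_deriveN
      (is_derive_comp (tp_dS CS _) (dphase s x)))
    (is_derive_cst (dot_tuple w x) s 1)) (is_derive_cst (bump k x) s 1).
  by move=> /is_derive_eq; apply; rewrite /osc2 /cst; ring.
- move=> s x _; apply: (le_trans (osc2_le s x)); exact: ler_wpM2r.
Qed.

Definition unit_tuple (i : 'I_n) : n.-tuple R := [tuple (j == i)%:R | j < n].

Lemma dot_unit_tuple x i : dot_tuple x (unit_tuple i) = tnth x i.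
Proof.
rewrite /dot_tuple (bigD1 i) //= tnth_mktuple eqxx mulr1 big1 ?addr0 // => j ji.
by rewrite tnth_mktuple (negbTE ji) mulr0.
Qed.

(** The divergence of the vector field x |-> C(t w.x) bump(k+1)(x) x. *)
Lemma sum_dtest_fun_unit t x :
  \sum_(i < n) dtest_fun C S k t 0 (unit_tuple i) w (unit_tuple i) x =
  n%:R * (C (t * dot_tuple w x) * bump (k + 1) x)
  - t * dot_tuple w x * S (t * dot_tuple w x) * bump (k + 1) x
  - 2 * (k + 1) * enorm x ^+ 2 * C (t * dot_tuple w x) * bump k x.
Proof.
pose c := C (t * dot_tuple w x); pose s := S (t * dot_tuple w x).
transitivity (\sum_(i < n) (c * bump (k + 1) x
   + tnth w i * tnth x i * (- t * s * bump (k + 1) x)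
   + tnth x i ^+ 2 * (- (2 * (k + 1)) * c * bump k x))).
  apply: eq_bigr => i _; rewrite /dtest_fun -/c -/s dot_unit_tuple.
  rewrite [dot_tuple _ x]dot_tupleC !dot_unit_tuple tnth_mktuple eqxx mul1r; ring.
rewrite !big_split /= -!mulr_suml -enormE sumr_const card_ord -/(dot_tuple w x).
by rewrite -mulr_natl /c /s; ring.
Qed.

(** Three families of derivatives integrate to zero: along w of S bump(k+1) and of
    (w.x) C bump(k+1), and the divergence of x C bump(k+1).  As
    bump(k+1) = (1 - |x|^2) bump(k), a combination of them is the integrand of
    the equation. *)
Lemma radial_ode t :
  t * ((\int[mu]_x osc0 t x) + \int[mu]_x osc2 t x)
  + (2 * k + n%:R + 1) * \int[mu]_x osc1 t x = 0.
Proof.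
have [i0 i1 i2] := integrable_osc t.
have k10 : k + 1 != 0 by rewrite gt_eqF // addr_gt0.
(* b makes the terms in (w.x)^2 C bump(k) agree, - b for the divergence cancels
   the terms in S bump(k+1), and a adjusts the terms in (w.x) S bump(k). *)
pose a := (2 * k + n%:R + 1) / (2 * (k + 1)).
pose b := t / (2 * (k + 1)).
have z (C' S' : R -> R) c0 u v : trig_pair C' S' ->
    has_int (dtest_fun C' S' k t c0 u w v) 0.
  move=> CS'; split; first exact: integrable_dtest_fun.
  exact: integral_dtest_fun.
have H1 := has_intZ a (z _ _ 1 [tuple 0 | i < n] w (trig_pair_quarter CS)).
have H2 := has_intZ b (z _ _ 0 w w CS).
have H3 := has_intZ (- b) (has_int_sum0 (fun i => z _ _ 0 (unit_tuple i) (unit_tuple i) CS)).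
have H := has_intD (has_intD H1 H2) H3.
have T : has_int (fun x => t * (osc0 t x + osc2 t x) + (2 * k + n%:R + 1) * osc1 t x)
    (t * ((\int[mu]_x osc0 t x) + \int[mu]_x osc2 t x)
      + (2 * k + n%:R + 1) * \int[mu]_x osc1 t x).
  by apply: has_intD; apply: has_intZ; [apply: has_intD|]; split.
have Z : a * 0 + b * 0 + - b * 0 = 0 :> R by ring.
have [_ <-] := T; have [_ HE] := H; rewrite -[RHS]Z -HE.
apply: eq_Rintegral => x _.
rewrite sum_dtest_fun_unit /dtest_fun /osc0 /osc1 /osc2 bumpS.
have -> : dot_tuple [tuple 0 | i < n] w = 0.
  by rewrite /dot_tuple big1 // => i _; rewrite tnth_mktuple mul0r.
have -> : dot_tuple [tuple 0 | i < n] x = 0.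
  by rewrite /dot_tuple big1 // => i _; rewrite tnth_mktuple mul0r.
rewrite dot_tupleE w1 expr1n /a /b.
set c := C _; set s := S _; set d := dot_tuple w x; set e := enorm x ^+ 2.
by field.
Qed.

End radial_ode.

Section energy.
Context {R : realType}.

(** For y'' + (2 m / t) y' + y = 0 and D = y' + m y / t, the energy
    E = t^(2 m) (D^2 + y^2) satisfies E' = 2 N t^(2 m) D y / t^2 with
    N = m (m - 1), hence E' <= N E / t^2.  So exp(N / t) E is nonincreasing, and
    E is bounded on [1, +oo[ in terms of y(1) and y'(1). *)
Lemma ode_decay (m A : R) (y0 y1 y2 : R -> R) : 1 <= m -> 0 <= A ->
  (forall t : R, 0 < t -> is_derive t 1 y0 (y1 t)) ->
  (forall t : R, 0 < t -> is_derive t 1 y1 (y2 t)) ->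
  (forall t, 0 < t -> t * (y0 t + y2 t) + (2 * m) * y1 t = 0) ->
  `|y0 1| <= A -> `|y1 1| <= A ->
  forall t, 1 <= t ->
    `|y0 t| <= Num.sqrt (expR (m * (m - 1)) * ((A + m * A) ^+ 2 + A ^+ 2)) * t `^ (- m).
Proof.
move=> m1 A0 d0 d1 ode b0 b1 t t1.
pose N := m * (m - 1).
have N0 : 0 <= N by rewrite mulr_ge0 //; lra.
pose D s := y1 s + m * (y0 s * s `^ (-1)).
pose Phi s := expR (N * s `^ (-1)) * (s `^ (2 * m) * (D s * D s + y0 s * y0 s)).
have dPhi (s : R) : 0 < s -> is_derive s 1 Phi
    (- (expR (N * s `^ (-1)) * s `^ (2 * m) * N * (s `^ (-1)) ^+ 2 * (D s - y0 s) ^+ 2)).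
  move=> s0.
  have sV : s `^ (-1) = s^-1 by rewrite powR_inv1 // ltW.
  have dV : is_derive s 1 (fun s : R => s `^ (-1)) (- (s^-1) ^+ 2).
    apply: (is_derive_eq (is_derive1_powR (-1) s0)).
    rewrite -opprD powRN (_ : 1 + 1 = 2%:R) // powR_mulrn ?(ltW s0) //.
    by rewrite mulN1r exprVn.
  have dq : is_derive s 1 (fun s : R => s `^ (2 * m)) (2 * m * s `^ (2 * m) * s^-1).
    apply: (is_derive_eq (is_derive1_powR (2 * m) s0)).
    by rewrite powRD ?(gt_eqF s0) ?implybT // sV mulrA.
  have dD := is_derive_add (d1 _ s0) (is_derive_mul (is_derive_cst m s 1)
    (is_derive_mul (d0 _ s0) dV)).
  have de := is_derive_comp (is_derive_expR _) (is_derive_mul (is_derive_cst N s 1) dV).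
  have dQ := is_derive_add (is_derive_mul dD dD) (is_derive_mul (d0 _ s0) (d0 _ s0)).
  have := is_derive_mul de (is_derive_mul dq dQ).
  move=> /is_derive_eq; apply; rewrite /D /N /cst /= !sV.
  have -> : y2 s = - y0 s - 2 * m * y1 s * s^-1.
    have h := ode _ s0.
    have -> : y2 s = s^-1 * (s * (y0 s + y2 s) + 2 * m * y1 s) - y0 s - 2 * m * y1 s * s^-1.
      by field; rewrite gt_eqF.
    by rewrite h mulr0 sub0r.
  set e := expR _; set q := s `^ (2 * m); set r := s^-1; ring.
have noninc : Phi t <= Phi 1.
  apply: (@ler0_derive1_nincry _ Phi 1) => //.
  - by move=> x; rewrite in_itv /= andbT => x1; have [] := dPhi x (lt_trans ltr01 x1).
  - move=> x; rewrite in_itv /= andbT => x1.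
    rewrite derive1E; have [_ ->] := dPhi x (lt_trans ltr01 x1).
    have sq0 (z : R) : 0 <= z ^+ 2 by exact: sqr_ge0.
    rewrite oppr_le0; apply: mulr_ge0 => //; apply: mulr_ge0 => //.
    by apply: mulr_ge0 => //; apply: mulr_ge0; [exact: expR_ge0|exact: powR_ge0].
  - apply: derivable_within_continuous => x; rewrite in_itv /= andbT => x1.
    by have [] := dPhi x (lt_le_trans ltr01 x1).
have t0 : 0 < t by exact: lt_le_trans t1.
set K := expR _ * _.
have K0 : 0 <= K by rewrite mulr_ge0 ?expR_ge0 // addr_ge0 ?sqr_ge0.
have Phi1 : Phi 1 <= K.
  rewrite /Phi /K /D !powR1 !mulr1 mul1r -!expr2; apply: ler_wpM2l; first exact: expR_ge0.
  apply: lerD.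
    have m0 : 0 <= m by lra.
    have AmA : 0 <= A + m * A by rewrite addr_ge0 // mulr_ge0.
    rewrite -real_normK ?num_real // lerXn2r ?nnegrE //.
    apply: (le_trans (ler_normD _ _)); apply: lerD => //.
    by rewrite normrM (ger0_norm m0); apply: ler_wpM2l.
  by rewrite -real_normK ?num_real // lerXn2r ?nnegrE.
have Phit : t `^ (2 * m) * y0 t ^+ 2 <= Phi t.
  rewrite /Phi -[leLHS]mul1r; apply: ler_pM => //.
  - by rewrite mulr_ge0 ?powR_ge0 ?sqr_ge0.
  - by rewrite -[leLHS]expR0 ler_expR mulr_ge0 ?powR_ge0.
  apply: ler_wpM2l; first exact: powR_ge0.
  by rewrite -!expr2 lerDr sqr_ge0.
have tm : t `^ (2 * m) = (t `^ m) ^+ 2.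
  by rewrite -powR_mulrn ?powR_ge0 // -powRrM mulrC.
have tm0 : 0 < t `^ m by exact: powR_gt0.
rewrite powRN ler_pdivlMr // -(ler_pXn2r (_ : 0 < 2)%N) ?nnegrE ?sqrtr_ge0 //; last first.
  by rewrite mulr_ge0 // ltW.
rewrite sqr_sqrtr // exprMn real_normK ?num_real // mulrC -tm.
exact: le_trans Phit (le_trans noninc Phi1).
Qed.

End energy.

(** * Decay of the Bochner-Riesz kernel *)
Section kernel_bound.
Context {R : realType} {n : nat}.
Local Notation mu := (@lebesgueN R n).
Implicit Types (x xi w : n.-tuple R).
Import ComplexField.Normc.

Lemma norm_Rintegral_unit_cube (f : n.-tuple R -> R) (M : R) :
  measurable_fun setT f ->
  (forall x, `|f x| <= M * \1_(cube [tuple 0 | i < n] 1) x) ->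
  `|\int[mu]_x f x| <= M * 2 ^+ n.
Proof.
move=> mf fM; have i_f := integrable_bounded_cube ler01 mf fM.
apply: (le_trans (le_normr_Rintegral measurableT i_f)).
pose g (x : n.-tuple R) : R := \1_(cube [tuple 0 | i < n] 1) x.
have mcube := measurable_cube [tuple (0 : R) | i < n] 1.
have mg : measurable_fun setT g by exact: measurable_indic.
have ig : mu.-integrable setT (EFin \o g).
  apply: (@integrable_bounded_cube _ _ _ [tuple 0 | i < n] 1 1) => //.
  by move=> x; rewrite mul1r ger0_norm.
have -> : M * 2 ^+ n = \int[mu]_x (M * g x).
  rewrite RintegralZl // /Rintegral /g integral_indic // setIT.
  by rewrite lebesgueN_cube // mulr1.
apply: le_Rintegral => //.
- have /integrableP[_ h] := i_f.
  apply/integrableP; split.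
    by apply/measurable_EFinP; exact: measurableT_comp mf.
  by under eq_integral do rewrite /= normr_id; exact: h.
- rewrite (_ : EFin \o _ = (fun x => M%:E * (EFin \o g) x)%E); last exact/funext.
  exact: integrableZl.
Qed.

Lemma br_multiplier_bump (lambda L : R) xi : 0 < L ->
  br_multiplier lambda L xi = bump lambda (affine_tuple L^-1 [tuple 0 | i < n] xi).
Proof.
move=> L0; have E : enorm (affine_tuple L^-1 [tuple 0 | i < n] xi) = enorm xi / L.
  rewrite /enorm (_ : \sum_(i < n) tnth (affine_tuple _ _ _) i ^+ 2 =
     (\sum_(i < n) tnth xi i ^+ 2) * (L^-1) ^+ 2).
    rewrite sqrtrM ?sqrtr_sqr ?gtr0_norm ?invr_gt0 //.
    by apply: sumr_ge0 => i _; exact: sqr_ge0.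
  by rewrite mulr_suml; apply: eq_bigr => i _; rewrite !tnth_mktuple addr0 exprMn mulrC.
rewrite /br_multiplier /bump /pospow E subr_gt0.
rewrite expr_lt1 //; last by rewrite divr_ge0 ?enorm_ge0 // ltW.
by rewrite ltr_pdivrMr // mul1r.
Qed.

Lemma dot_affine (a : R) x xi :
  dot_tuple x (affine_tuple a [tuple 0 | i < n] xi) = a * dot_tuple x xi.
Proof.
rewrite /dot_tuple mulr_sumr; apply: eq_bigr => i _.
by rewrite !tnth_mktuple addr0; ring.
Qed.

(** With F = cos or sin, these are the two parts of the Fourier transform of the
    bump, up to the normalization of the frequency. *)
Definition osc_int (F : R -> R) (k : R) x : R :=
  \int[mu]_xi (F (dot_tuple x xi) * bump k xi).

Definition dilate (a : R) x : n.-tuple R := affine_tuple a [tuple 0 | i < n] x.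

Lemma dot_dilatel (a : R) x xi : dot_tuple (dilate a x) xi = a * dot_tuple x xi.
Proof. by rewrite dot_tupleC dot_affine dot_tupleC. Qed.

Lemma measurable_osc_int (F : R -> R) k x : measurable_fun setT F ->
  measurable_fun setT (fun xi => F (dot_tuple x xi) * bump k xi).
Proof.
move=> mF; apply: measurable_funM; last exact: measurable_bump.
by apply: (@measurableT_comp _ _ _ _ _ _ F) => //; exact: measurable_dot_tuple.
Qed.

Lemma br_kernel_scaled (lambda L : R) x : 0 < L ->
  br_kernel lambda L x =
  (Complex (L ^+ n * osc_int cos lambda (dilate (2 * pi * L) x))
           (L ^+ n * osc_int sin lambda (dilate (2 * pi * L) x))).
Proof.
move=> L0; have Li0 : 0 < L^-1 by rewrite invr_gt0.
have H (F : R -> R) : measurable_fun setT F ->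
   \int[mu]_xi (F (2 * pi * dot_tuple x xi) * br_multiplier lambda L xi) =
   L ^+ n * osc_int F lambda (dilate (2 * pi * L) x).
  move=> mF.
  have := Rintegral_affine [tuple 0 | i < n] Li0
    (measurable_osc_int lambda (dilate (2 * pi * L) x) mF).
  rewrite exprVn invrK => <-; apply: eq_Rintegral => xi _.
  rewrite br_multiplier_bump // dot_affine dot_dilatel; congr (F _ * _).
  by field; rewrite gt_eqF.
rewrite /br_kernel /inv_fourier /cintegral; congr Complex.
  rewrite -H; last by apply: continuous_measurable_fun; exact: continuous_cos.
  by apply: eq_Rintegral => xi _; rewrite /= mulr0 subr0.
rewrite -H; last by apply: continuous_measurable_fun; exact: continuous_sin.
by apply: eq_Rintegral => xi _; rewrite /= mulr0 add0r.
Qed.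

Lemma osc_int_le (C S : R -> R) k x : trig_pair C S -> 0 <= k ->
  `|osc_int C k x| <= 2 ^+ n.
Proof.
move=> CS k0; rewrite -[leRHS]mul1r; apply: norm_Rintegral_unit_cube.
  exact: measurable_osc_int (tp_mC CS).
by move=> xi; apply: norm_mul_bump_le => // _; exact: tp_bC CS _.
Qed.

(** On the ray through x the integral solves the radial equation, with initial
    values at t = 1 that are bounded uniformly in the direction. *)
Lemma osc_int_decay (k : R) : (0 < n)%N -> 0 < k ->
  exists2 K : R, 0 <= K & forall (C S : R -> R) x, trig_pair C S ->
    1 <= enorm x -> `|osc_int C k x| <= K * enorm x `^ (- (k + (n%:R + 1) / 2)).
Proof.
move=> n0 k0; pose m := k + (n%:R + 1) / 2.
have n1 : 1 <= n%:R :> R by rewrite ler1n.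
have m1 : 1 <= m by rewrite /m; lra.
(* 2^n is the measure of the unit cube, and n bounds the l1 norm of a unit
   vector w, hence w.x on the unit cube. *)
pose A : R := n%:R * 2 ^+ n.
have A0 : 0 <= A by rewrite mulr_ge0 // exprn_ge0.
exists (Num.sqrt (expR (m * (m - 1)) * ((A + m * A) ^+ 2 + A ^+ 2))).
  exact: sqrtr_ge0.
move=> C S x CS x1; have x0 : 0 < enorm x by exact: lt_le_trans x1.
pose w := dilate (enorm x)^-1 x.
have w1 : enorm w = 1.
  have w2 : enorm w ^+ 2 = 1.
    rewrite -dot_tupleE dot_dilatel dot_affine dot_tupleE.
    by rewrite expr2; field; rewrite gt_eqF.
  by apply/eqP; rewrite -(@eqrXn2 _ 2) ?enorm_ge0 // w2 expr1n.
have xw : x = dilate (enorm x) w.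
  apply: eq_from_tnth => i; rewrite !tnth_mktuple !addr0 mulrA mulfV ?mul1r //.
  by rewrite gt_eqF.
have E : osc_int C k x = \int[mu]_xi osc0 C k w (enorm x) xi.
  apply: eq_Rintegral => xi _; rewrite /osc0; congr (C _ * _).
  by rewrite [in LHS]xw dot_dilatel.
rewrite E.
have nw : norm1 w <= n%:R.
  rewrite (_ : n%:R = \sum_(i < n) 1); last by rewrite sumr_const card_ord.
  by apply: ler_sum => i _; rewrite -w1; exact: tnth_le_enorm.
apply: (ode_decay (y0 := fun t => \int[mu]_xi osc0 C k w t xi)
  (y1 := fun t => \int[mu]_xi osc1 S k w t xi)
  (y2 := fun t => \int[mu]_xi osc2 C k w t xi) m1 A0) => //.
- by move=> t _; apply: is_derive_osc0.
- by move=> t _; apply: is_derive_osc1.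
- move=> t _; have := radial_ode CS k0 w1 t.
  by rewrite (_ : 2 * k + n%:R + 1 = 2 * m) // /m; field.
- have [m0 _ _] := measurable_osc CS k w 1.
  apply: (le_trans (norm_Rintegral_unit_cube m0 (osc0_le CS k0 w 1))).
  by rewrite ler_wpM2r // exprn_ge0.
- have [_ m0 _] := measurable_osc CS k w 1.
  apply: (le_trans (norm_Rintegral_unit_cube m0 (osc1_le CS k0 w 1))).
  by rewrite ler_wpM2r // exprn_ge0.
Qed.

Lemma normc_le_abs (a b : R) : normc (Complex a b) <= `|a| + `|b|.
Proof.
rewrite /normc -(ler_pXn2r (_ : 0 < 2)%N) ?nnegrE ?sqrtr_ge0 ?addr_ge0 //.
rewrite sqr_sqrtr ?addr_ge0 ?sqr_ge0 // sqrrD !real_normK ?num_real //.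
by rewrite -addrA [_ *+ 2 + _]addrC addrA lerDl mulrn_wge0 // mulr_ge0.
Qed.

Lemma enorm_dilate (a : R) x : 0 <= a -> enorm (dilate a x) = a * enorm x.
Proof.
move=> a0; apply/eqP; rewrite -(@eqrXn2 _ 2) ?enorm_ge0 ?mulr_ge0 ?enorm_ge0 //.
by rewrite -dot_tupleE dot_dilatel dot_affine dot_tupleE exprMn expr2 mulrA.
Qed.

Lemma br_kernel_le (lambda : R) : (0 < n)%N -> 0 < lambda ->
  exists2 K : R, 0 < K & forall (L : R) x, 0 < L ->
    normc (br_kernel lambda L x) <= K * L ^+ n /\
    (1 <= L * enorm x -> normc (br_kernel lambda L x) <=
       K * L ^+ n * (L * enorm x) `^ (- (lambda + (n%:R + 1) / 2))).
Proof.
move=> n0 l0; have [K K0 HK] := osc_int_decay n0 l0.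
pose m := lambda + (n%:R + 1) / 2.
have m0 : 0 <= m by rewrite addr_ge0 ?(ltW l0) // divr_ge0 // addr_ge0.
have tn0 : 0 < 2 ^+ n :> R by rewrite exprn_gt0.
have cs := @trig_pair_cos_sin R.
have sc := trig_pair_quarter cs.
exists (2 * (K + 2 ^+ n)); first by rewrite mulr_gt0 // ltr_wpDl.
move=> L x L0; rewrite br_kernel_scaled //.
have Ln0 : 0 <= L ^+ n by rewrite exprn_ge0 // ltW.
split.
  apply: (le_trans (normc_le_abs _ _)); rewrite !normrM (ger0_norm Ln0) -mulrDr.
  rewrite mulrC; apply: ler_wpM2r => //.
  have := osc_int_le (dilate (2 * pi * L) x) cs (ltW l0).
  have := osc_int_le (dilate (2 * pi * L) x) sc (ltW l0).
  by lra.
move=> Lx.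
have pi2 : 1 <= 2 * pi :> R by have := @pi_ge2 R; lra.
have P0 : 0 <= 2 * pi * L by rewrite mulr_ge0 ?(ltW L0) //; lra.
have E : enorm (dilate (2 * pi * L) x) = (2 * pi) * (L * enorm x).
  by rewrite enorm_dilate // mulrA.
have E1 : 1 <= enorm (dilate (2 * pi * L) x).
  by rewrite E -[leLHS]mulr1 ler_pM.
have pw : enorm (dilate (2 * pi * L) x) `^ (- m) <= (L * enorm x) `^ (- m).
  have Lx0 : 0 < L * enorm x by exact: lt_le_trans Lx.
  rewrite !powRN lef_pV2 ?posrE ?powR_gt0 //; last exact: lt_le_trans E1.
  rewrite ge0_ler_powR ?nnegrE ?(ltW Lx0) //; first by rewrite (le_trans _ E1).
  by rewrite E ler_peMl // ltW.
have B (C S : R -> R) : trig_pair C S ->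
  `|osc_int C lambda (dilate (2 * pi * L) x)| <= (K + 2 ^+ n) * (L * enorm x) `^ (- m).
  move=> CS; apply: (le_trans (HK _ _ _ CS E1)).
  by apply: ler_pM; rewrite ?powR_ge0 // lerDl ltW.
apply: (le_trans (normc_le_abs _ _)); rewrite !normrM (ger0_norm Ln0) -mulrDr -/m.
have := lerD (B _ _ cs) (B _ _ sc).
move=> /(ler_wpM2l Ln0) /le_trans; apply.
by rewrite le_eqVlt; apply/orP; left; apply/eqP; ring.
Qed.

End kernel_bound.

(** * Domination by the maximal function *)
Section domination_by_maximal_function.
Context {R : realType} {n : nat}.
Local Notation mu := (@lebesgueN R n).
Implicit Types (x y : n.-tuple R) (F : n.-tuple R -> \bar R).
Import ComplexField.Normc.

(** Replacing H by +oo on a Borel null set makes the domination hold everywhere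
    without changing the integral of H; the integrals of the positive and negative
    parts of h, measurable or not, are then monotone. *)
Lemma norm_Rintegral_le_ae (h : n.-tuple R -> R) (H : n.-tuple R -> \bar R) :
  measurable_fun setT H -> (forall y, 0 <= H y)%E ->
  {ae mu, forall y, (`|h y|%:E <= H y)%E} ->
  (`|\int[mu]_y h y|%:E <= \int[mu]_y H y)%E.
Proof.
move=> mH H0 [N [mN N0 hN]].
pose H' y : \bar R := if y \in N then +oo%E else H y.
have mH' : measurable_fun setT H'.
  apply: measurable_fun_ifT => //; apply: (measurable_fun_bool true).
  rewrite setTI (_ : _ @^-1` _ = N) //.
  by apply/seteqP; split => y; [exact: set_mem|exact: mem_set].
have H'0 y : (0 <= H' y)%E by rewrite /H'; case: ifP.
have hH' y : (`|h y|%:E <= H' y)%E.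
  rewrite /H'; case: ifPn => [_|/negP yN]; first by rewrite leey.
  by apply: contrapT => nh; apply: yN; rewrite inE; apply: hN.
have HE : (\int[mu]_y H y = \int[mu]_y H' y)%E.
  apply: ae_eq_integral => //; exists N; split => // y /= nE.
  apply: contrapT => yN; apply: nE => _; rewrite /H' ifF //.
  by apply/negP; rewrite inE.
rewrite HE /Rintegral integralE.
have P : (\int[mu]_y (fun y => (h y)%:E)^\+ y <= \int[mu]_y H' y)%E.
  apply: le_integral_nonmeasurable => y _ //.
  rewrite funeposE; apply: le_trans (hH' y).
  by rewrite ge_max !lee_fin ler_norm normr_ge0.
have M : (\int[mu]_y (fun y => (h y)%:E)^\- y <= \int[mu]_y H' y)%E.
  apply: le_integral_nonmeasurable => y _ //.
  rewrite funenegE; apply: le_trans (hH' y).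
  by rewrite ge_max !lee_fin normr_ge0 -normrN ler_norm.
have P0 : (0 <= \int[mu]_y (fun y => (h y)%:E)^\+ y)%E by exact: integral_ge0.
have M0 : (0 <= \int[mu]_y (fun y => (h y)%:E)^\- y)%E by exact: integral_ge0.
move: P M P0 M0.
case: (\int[mu]_y H' y)%E => [r| |]; last 2 first.
- by move=> *; rewrite leey.
- by move=> P _ P0 _; have := le_trans P0 P.
case: (\int[mu]_y _ ^\+ y)%E => // a; case: (\int[mu]_y _ ^\- y)%E => // b.
rewrite !lee_fin /= => ar br a0 b0.
by rewrite ler_norml; apply/andP; split; lra.
Qed.

Lemma normcE (z : R[i]) :
  normc z = Num.sqrt (complex.Re z ^+ 2 + complex.Im z ^+ 2).
Proof. by case: z. Qed.

Lemma Re_le_normc (z : R[i]) : `|complex.Re z| <= normc z.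
Proof.
rewrite normcE -(ler_pXn2r (_ : 0 < 2)%N) ?nnegrE ?sqrtr_ge0 //.
by rewrite sqr_sqrtr ?addr_ge0 ?sqr_ge0 // real_normK ?num_real // lerDl sqr_ge0.
Qed.

Lemma Im_le_normc (z : R[i]) : `|complex.Im z| <= normc z.
Proof.
rewrite normcE -(ler_pXn2r (_ : 0 < 2)%N) ?nnegrE ?sqrtr_ge0 //.
by rewrite sqr_sqrtr ?addr_ge0 ?sqr_ge0 // real_normK ?num_real // lerDr sqr_ge0.
Qed.

Lemma normc_ge0 (z : R[i]) : 0 <= normc z.
Proof. by rewrite normcE sqrtr_ge0. Qed.

Lemma normc_cintegral_le (g : n.-tuple R -> R[i]) (H : n.-tuple R -> \bar R) :
  measurable_fun setT H -> (forall y, 0 <= H y)%E ->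
  {ae mu, forall y, ((normc (g y))%:E <= H y)%E} ->
  ((normc (cintegral g))%:E <= 2%:E * \int[mu]_y H y)%E.
Proof.
move=> mH H0 gH.
have a1 : (`|\int[mu]_y complex.Re (g y)|%:E <= \int[mu]_y H y)%E.
  apply: norm_Rintegral_le_ae => //; apply: filterS gH => y.
  by apply: le_trans; rewrite lee_fin; exact: Re_le_normc.
have a2 : (`|\int[mu]_y complex.Im (g y)|%:E <= \int[mu]_y H y)%E.
  apply: norm_Rintegral_le_ae => //; apply: filterS gH => y.
  by apply: le_trans; rewrite lee_fin; exact: Im_le_normc.
apply: (@le_trans _ _ ((`|\int[mu]_y complex.Re (g y)| + `|\int[mu]_y complex.Im (g y)|)%:E)).
  by rewrite lee_fin; exact: normc_le_abs.
rewrite EFinD; apply: (le_trans (leeD a1 a2)).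
by rewrite (_ : 2%:E = 1%:E + 1%:E)%E // ge0_muleDl // !mul1e.
Qed.

Lemma sub_tuple_cube x y (r : R) : enorm (sub_tuple x y) <= r -> cube x r y.
Proof.
move=> h i; apply: le_trans h; rewrite distrC.
by have := tnth_le_enorm (sub_tuple x y) i; rewrite tnth_mktuple.
Qed.

(** With e = L |x - y| and j least such that e <= 2^j, the kernel is at most
    K 2^m L^n 2^(- m j), and y lies in the cube about x of half-side 2^j / L.
    The integral of F over this cube is at most (4 2^j / L)^n M F(x), which
    leaves the geometric series of ratio 2^(n - m) < 1. *)
Lemma bochner_riesz_le_maximal (lambda : R) : (0 < n)%N ->
  (n%:R - 1) / 2 < lambda ->
  exists2 C : R, 0 < C & forall (f : n.-tuple R -> R[i]) F (L : R) x,
    measurable_fun setT F -> (forall y, 0 <= F y)%E ->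
    {ae mu, forall y, ((normc (f y))%:E <= F y)%E} -> 0 < L ->
    ((normc (bochner_riesz lambda L f x))%:E <= C%:E * HL_maximal F x)%E.
Proof.
move=> n0 lam; have n1 : 1 <= n%:R :> R by rewrite ler1n.
have l0 : 0 < lambda by apply: le_lt_trans lam; rewrite divr_ge0 // subr_ge0.
have [K K0 HK] := br_kernel_le n0 l0.
pose m := lambda + (n%:R + 1) / 2.
have m0 : 0 <= m by rewrite /m; lra.
have mn : n%:R - m < 0 by rewrite /m; lra.
pose z : R := 2 `^ (n%:R - m).
have z01 : 0 <= z < 1 by rewrite powR_ge0 powR2_lt1.
have zE : z = 2 ^+ n * 2 `^ (- m).
  by rewrite /z powRD ?pnatr_eq0 ?implybT // powR_mulrn.
pose B : R := K * 2 `^ m * 4 ^+ n.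
have B0 : 0 < B by rewrite !mulr_gt0 ?powR_gt0 ?exprn_gt0.
pose C := 2 * (B / (1 - z)).
have C0 : 0 < C by rewrite mulr_gt0 // divr_gt0 // subr_gt0; case/andP: z01.
exists C => // f F L x mF F0 fF L0.
pose kap j : R := K * L ^+ n * 2 `^ m * (2 `^ (- m)) ^+ j.
have kap0 j : 0 <= kap j.
  by rewrite !mulr_ge0 ?exprn_ge0 ?powR_ge0 ?(ltW K0) ?(ltW L0).
pose rad j : R := 2 ^+ j / L.
have rad0 j : 0 < rad j by rewrite divr_gt0 // exprn_gt0.
pose T j y : \bar R := ((kap j * \1_(cube x (rad j)) y)%:E * F y)%E.
have T0 j y : (0 <= T j y)%E by rewrite mule_ge0 // lee_fin mulr_ge0.
have mT j : measurable_fun setT (T j).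
  apply: emeasurable_funM => //; apply/measurable_EFinP; apply: measurable_funM => //.
  by apply: measurable_indic; exact: measurable_cube.
pose H y := (\sum_(0 <= j <oo) T j y)%E.
have mH : measurable_fun setT H by exact: ge0_emeasurable_sum.
have H0 y : (0 <= H y)%E by exact: nneseries_ge0.
have key y : ((normc (f y))%:E <= F y)%E ->
    ((normc (f y * br_kernel lambda L (sub_tuple x y)))%:E <= H y)%E.
  move=> fy; rewrite normcM EFinM muleC.
  pose e := L * enorm (sub_tuple x y).
  have [k1 k2] := HK L (sub_tuple x y) L0.
  have e0 : 0 <= e by rewrite mulr_ge0 ?enorm_ge0 // ltW.
  have ex : exists j : nat, e <= 2 ^+ j.
    exists (Num.truncn e).+1; apply/ltW/(lt_le_trans (truncnS_gt _)).
    by rewrite -natrX ler_nat; exact/ltnW/ltn_expl.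
  have jP := ex_minnP ex; case: jP => j hj jmin.
  have yj : cube x (rad j) y.
    by apply: sub_tuple_cube; rewrite ler_pdivlMr // mulrC.
  apply: (@le_trans _ _ (T j y)); last exact: (nneseries_ge_term (u := T ^~ y)).
  rewrite /T indicE mem_set // mulr1.
  apply: lee_pmul => //; rewrite lee_fin ?normc_ge0 // /kap.
  case: j hj jmin {yj} => [|j] hj jmin.
    rewrite expr0 mulr1; apply: (le_trans k1); rewrite ler_peMr //.
      by rewrite mulr_ge0 ?exprn_ge0 ?(ltW K0) ?(ltW L0).
    by rewrite -[leLHS](powRr0 2) ler_powR ?ler1n.
  have ej : 2 ^+ j < e.
    by rewrite ltNge; apply/negP => /jmin; rewrite ltnn.
  have j1 : 1 <= 2 ^+ j :> R by rewrite exprn_ege1 // ler1n.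
  apply: (le_trans (k2 (ltW (le_lt_trans j1 ej)))); rewrite -[leRHS]mulrA.
  apply: ler_wpM2l; first by rewrite mulr_ge0 ?exprn_ge0 ?(ltW K0) ?(ltW L0).
  rewrite -/m -/e exprS mulrA -powRD ?pnatr_eq0 ?implybT // subrr powRr0 mul1r.
  have -> : (2 `^ (- m)) ^+ j = (2 ^+ j) `^ (- m) :> R.
    by rewrite -!powR_mulrn ?powR_ge0 // -!powRrM mulrC.
  have p2 : 0 < 2 ^+ j :> R by rewrite exprn_gt0.
  have e1 : 0 < e by exact: lt_trans ej.
  rewrite !powRN lef_pV2 ?posrE ?powR_gt0 //.
  by rewrite ge0_ler_powR ?nnegrE ?exprn_ge0 // ltW.
apply: (@le_trans _ _ (2%:E * \int[mu]_y H y)%E).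
  apply: normc_cintegral_le => //; exact: filterS fF.
rewrite /C EFinM -muleA; apply: lee_wpmul2l => //.
rewrite integral_nneseries //.
apply: (@le_trans _ _ (\sum_(0 <= j <oo) (HL_maximal F x * (B * z ^+ j)%:E))%E).
  apply: lee_nneseries => j _; first by move=> _; exact: integral_ge0.
  have -> : (\int[mu]_y T j y = (kap j)%:E * \int[mu]_(y in cube x (rad j)) F y)%E.
    rewrite [in RHS]integral_mkcond -ge0_integralZl ?lee_fin //; last 2 first.
    - apply/(measurable_restrictT _ _).1; first exact: measurable_cube.
      exact: measurable_funTS.
    - by move=> y _; rewrite /patch; case: ifP.
    apply: eq_integral => y _; rewrite /T /patch EFinM -muleA indicE; congr (_ * _)%E.
    by case: ifPn => _; rewrite ?mul1e ?mul0e.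
  apply: (@le_trans _ _ ((kap j)%:E * (((4 * rad j) ^+ n)%:E * HL_maximal F x))%E).
    by apply: lee_wpmul2l; [rewrite lee_fin|exact: integral_cube_le_maximal].
  rewrite muleA -EFinM muleC le_eqVlt; apply/orP; left; apply/eqP; congr (_ * _%:E)%E.
  rewrite /kap /rad /B zE.
  rewrite exprMn expr_div_n exprMn -!exprM [(n * j)%N]mulnC.
  have Ln : L ^+ n != 0 by rewrite expf_neq0 // gt_eqF.
  move: Ln; set a := L ^+ n; set b := 2 `^ m; set c := _ ^+ j.
  by set d := 2 ^+ (j * n); set e := 4 ^+ n => a0; field.
have HL0 : (0 <= HL_maximal F x)%E by exact: HL_maximal_ge0.
have c1 : 0 < B / (1 - z) by rewrite divr_gt0 // subr_gt0; case/andP: z01.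
case: (HL_maximal F x) HL0 => [r| |] // r0; last by rewrite gt0_muley ?leey.
rewrite nneseriesZl; last by move=> j _; rewrite lee_fin mulr_ge0 ?exprn_ge0 ?(ltW B0) //; case/andP: z01.
rewrite muleC; apply: lee_wpmul2r => //.
by apply: nneseries_geometric => //; exact: ltW.
Qed.

Lemma max_bochner_riesz_le_maximal (lambda : R) : (0 < n)%N ->
  (n%:R - 1) / 2 < lambda ->
  exists2 C : R, 0 < C & forall (f : n.-tuple R -> R[i]) F x,
    measurable_fun setT F -> (forall y, 0 <= F y)%E ->
    {ae mu, forall y, ((normc (f y))%:E <= F y)%E} ->
    (max_bochner_riesz lambda f x <= C%:E * HL_maximal F x)%E.
Proof.
move=> n0 lam; have [C C0 H] := bochner_riesz_le_maximal n0 lam.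
exists C => // f F x mF F0 fF; apply: ge_ereal_sup => _ [L /= L0 <-].
exact: H.
Qed.

Lemma max_bochner_riesz_ge0 (lambda : R) (f : n.-tuple R -> R[i]) x :
  (0 <= max_bochner_riesz lambda f x)%E.
Proof.
apply: (@le_trans _ _ (normc (bochner_riesz lambda 1 f x))%:E).
  by rewrite lee_fin normc_ge0.
by apply: ereal_sup_ubound; exists 1 => //=.
Qed.

End domination_by_maximal_function.

(** * The maximal function of a block *)
Section block_estimate.
Context {R : realType} {n : nat}.
Local Notation mu := (@lebesgueN R n).
Implicit Types (x y : n.-tuple R) (a : n.-tuple R -> R[i]).
Import ComplexField.Normc.

Lemma measurable_normc a :
  measurable_fun [set: n.-tuple R] (fun x => complex.Re (a x)) ->
  measurable_fun [set: n.-tuple R] (fun x => complex.Im (a x)) ->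
  measurable_fun [set: n.-tuple R] (fun x => normc (a x)).
Proof.
move=> mRe mIm.
rewrite (_ : (fun x => _) =
  Num.sqrt \o (fun x => complex.Re (a x) ^+ 2 + complex.Im (a x) ^+ 2)); last first.
  by apply/funext => x; rewrite /= normcE.
apply: (@measurableT_comp _ _ _ _ _ _ (@Num.sqrt R)).
  by apply: continuous_measurable_fun; exact: sqrt_continuous.
by apply: measurable_funD; exact: measurable_funX.
Qed.

Lemma HL_maximalZ (c : R) (F : n.-tuple R -> \bar R) x :
  0 <= c -> (forall y, 0 <= F y)%E -> measurable_fun setT F ->
  (HL_maximal (fun y => c%:E * F y) x <= c%:E * HL_maximal F x)%E.
Proof.
move=> c0 F0 mF; apply: ge_ereal_sup => _ [j _ <-].
rewrite indicE; case: (boolP (x \in rcube j)); last first.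
  by rewrite mule0 mule_ge0 ?HL_maximal_ge0 ?lee_fin.
rewrite inE mule1 => xj; rewrite /cube_average ge0_integralZl ?lee_fin //; last 2 first.
- exact: measurable_cube.
- exact: measurable_funTS.
rewrite muleCA; apply: lee_wpmul2l; first by rewrite lee_fin.
exact: cube_average_le_maximal.
Qed.

Lemma supp_eq0 a (B : set (n.-tuple R)) x : supp a `<=` B -> ~ B x -> a x = 0.
Proof.
move=> aB xB; apply: contrapT => /eqP ax; apply: xB; apply: aB => e e0.
exists x => //; rewrite /enorm big1 ?sqrtr0 // => i _.
by rewrite tnth_mktuple subrr expr0n.
Qed.

(** Dividing the block by t0 = V^(- th / p), where V is the measure of its ball,
    gives a function F with int F^s <= V; then the bound C V^th of
    [weighted_maximal_le] is exactly compensated by t0^p. *)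
Lemma block_maximal_le (s p alpha : R) : (0 < n)%N -> 1 < s -> 0 < p ->
  n%:R * (p / s - 1) < alpha -> alpha < n%:R * (p - 1) -> alpha <= 0 ->
  exists2 C : R, 0 < C & forall a, is_block p s%:E alpha a ->
    (\int[mu]_x (HL_maximal (fun y => (normc (a y))%:E) x `^ p * (enorm x `^ alpha)%:E)
     <= C%:E)%E.
Proof.
move=> n0 s1 p0 a1 a2 a0.
have nR : 0 < n%:R :> R by rewrite ltr0n.
have s0 : 0 < s by lra.
have [C C0 HC] := weighted_maximal_le n0 s1 p0 a1 a2 a0.
exists C => // a [mRe mIm [x0 [r [r0 aB aL]]]].
have mN := measurable_normc mRe mIm.
pose B := eball x0 r; pose V := fine (mu B).
have B0 : (0 < mu B)%E by exact: lebesgueN_eball_gt0.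
have Bf : mu B \is a fin_num by rewrite ge0_fin_numE ?ltW // lebesgueN_eball_fin.
have BV : mu B = V%:E by rewrite /V fineK.
have V0 : 0 < V by rewrite -lte_fin -BV.
pose th := 1 + alpha / n%:R.
pose t0 := V `^ (- (th / p)).
have t00 : 0 < t0 by rewrite powR_gt0.
have ti0 : 0 <= t0^-1 by rewrite invr_ge0 ltW.
pose N y := normc (a y).
have N0 y : 0 <= N y by exact: normc_ge0.
pose F y := t0^-1 * N y.
have F0 y : 0 <= F y by rewrite mulr_ge0.
have mF : measurable_fun setT F by apply: measurable_funM.
have mNs := measurable_powR_comp s mN.
have Ns : (\int[mu]_x (N x `^ s)%:E <= (t0 `^ s * V)%:E)%E.
  have E : (\int[mu]_x (N x `^ s)%:E = Lnorm mu s%:E (fun x => (N x)%:E) `^ s)%E.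
    rewrite powR_Lnorm ?gt_eqF //; apply: eq_integral => x _.
    by rewrite /= ger0_norm.
  rewrite E.
  have := aL; rewrite -/B BV inver gt_eqF //= => aL'.
  have := gt0_ler_poweR (ltW s0) _ _ aL'.
  rewrite !in_itv /= !leey !andbT Lnorm_ge0 lee_fin powR_ge0 => /(_ isT isT).
  move=> /le_trans; apply; rewrite lee_fin -powRrM /t0 -powRrM.
  rewrite -{3}[V](powRr1 (ltW V0)) -powRD ?(gt_eqF V0) ?implybT //.
  rewrite le_eqVlt; apply/orP; left; apply/eqP; congr (V `^ _).
  by rewrite /th; field; rewrite !gt_eqF.
have Fs : (\int[mu]_x (F x `^ s)%:E <= V%:E)%E.
  have ts0 : 0 < t0 `^ s by rewrite powR_gt0.
  have FE x : F x `^ s = (t0 `^ s)^-1 * N x `^ s.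
    rewrite /F powRM //; congr (_ * _).
    by rewrite -powR_inv1 ?(ltW t00) // -powRrM mulN1r powRN.
  under eq_integral do rewrite FE EFinM.
  rewrite ge0_integralZl ?lee_fin ?invr_ge0 ?(ltW ts0) //; last 2 first.
  - exact/measurable_EFinP.
  - by move=> x _; rewrite lee_fin powR_ge0.
  by rewrite lee_pdivrMl // -EFinM.
have FB x : ~ B x -> F x = 0.
  by move=> xB; rewrite /F /N (supp_eq0 aB xB) normc0 mulr0.
have BV' : (mu B <= V%:E)%E by rewrite BV.
have H := HC V B F mF F0 (measurable_eball x0 r) FB V0 BV' Fs.
have FM x : (HL_maximal (fun y => (N y)%:E) x <=
    t0%:E * HL_maximal (fun y => (F y)%:E) x)%E.
  have -> : (fun y => (N y)%:E) = (fun y => t0%:E * (F y)%:E)%E.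
    apply/funext => y; rewrite -EFinM /F mulrA mulfV ?mul1r //.
    by rewrite gt_eqF.
  apply: HL_maximalZ; first exact: ltW.
  - by move=> y; rewrite lee_fin.
  - exact/measurable_EFinP.
have HF0 x : (0 <= HL_maximal (fun y => (F y)%:E) x)%E.
  by apply: HL_maximal_ge0 => y; rewrite lee_fin.
have HN0 x : (0 <= HL_maximal (fun y => (N y)%:E) x)%E.
  by apply: HL_maximal_ge0 => y; rewrite lee_fin.
have tp0 : 0 <= t0 `^ p by rewrite powR_ge0.
apply: (@le_trans _ _ (\int[mu]_x ((t0 `^ p)%:E *
   (HL_maximal (fun y => (F y)%:E) x `^ p * (enorm x `^ alpha)%:E)))%E).
  apply: le_integral_nonmeasurable => x _.
    by rewrite mule_ge0 ?poweR_ge0 // lee_fin powR_ge0.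
  rewrite muleA; apply: lee_wpmul2r; first by rewrite lee_fin powR_ge0.
  rewrite -poweR_EFin -poweRM ?lee_fin ?(ltW t00) //.
  apply: gt0_ler_poweR; rewrite ?in_itv /= ?leey ?andbT ?(ltW p0) //.
  by rewrite mule_ge0 // lee_fin ltW.
have mHF : measurable_fun setT (HL_maximal (fun y => (F y)%:E)).
  by apply: measurable_HL_maximal => y; rewrite lee_fin.
rewrite ge0_integralZl ?lee_fin //; last 2 first.
- apply: emeasurable_funM; last by apply/measurable_EFinP; exact: measurable_weight.
  by apply: (measurableT_comp (measurable_poweR p)).
- by move=> x _; rewrite mule_ge0 ?poweR_ge0 // lee_fin powR_ge0.
have tp1 : (0 <= (t0 `^ p)%:E)%E by rewrite lee_fin.
apply: (le_trans (lee_wpmul2l tp1 H)).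
rewrite -EFinM lee_fin -/th /t0 -powRrM mulrCA -powRD ?(gt_eqF V0) ?implybT //.
rewrite (_ : - (th / p) * p + th = 0) ?powRr0 ?mulr1 //.
by field; rewrite gt_eqF.
Qed.

End block_estimate.

(** * Powers of series *)
Section power_of_series.
Context {R : realType}.
Local Open Scope ereal_scope.
Implicit Types (c : nat -> R) (g : nat -> \bar R).

(** For u in ]0, 1] and p <= 1 one has u <= u^p: apply it to x / (x + y) and to
    y / (x + y). *)
Lemma poweR_leD (p : R) (x y : \bar R) : (0 < p)%R -> (p <= 1)%R ->
  0 <= x -> 0 <= y -> (x + y) `^ p <= x `^ p + y `^ p.
Proof.
move=> p0 p1; have pn : p != 0%R by rewrite gt_eqF.
case: x => [x| |] // x0; case: y => [y| |] // y0; last 3 first.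
- by rewrite addey // poweRyr // addey ?leey // gt_eqF // (lt_le_trans _ (poweR_ge0 _ _)).
- by rewrite addye // poweRyr // addye ?leey // gt_eqF // (lt_le_trans _ (poweR_ge0 _ _)).
- by rewrite addye // poweRyr // addye ?leey // gt_eqF // (lt_le_trans _ (poweR_ge0 _ _)).
move: x0 y0; rewrite -EFinD !poweR_EFin -EFinD !lee_fin => x0 y0.
move: x0; rewrite le_eqVlt => /orP[/eqP <-|x0]; first by rewrite add0r powR0 // add0r.
move: y0; rewrite le_eqVlt => /orP[/eqP <-|y0]; first by rewrite addr0 powR0 // addr0.
have xy : (0 < x + y)%R by rewrite addr_gt0.
have h z : (0 < z)%R -> (z <= x + y)%R -> (z / (x + y) * (x + y) `^ p <= z `^ p)%R.
  move=> z0 zxy.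
  have -> : (z `^ p = (z / (x + y)) `^ p * (x + y) `^ p)%R.
    by rewrite -powRM ?divr_ge0 ?ltW // divfK // lt0r_neq0.
  apply: ler_wpM2r; first exact: powR_ge0.
  by apply: ger1_powR => //; rewrite divr_gt0 //= ler_pdivrMr // mul1r.
have hx : (x <= x + y)%R by rewrite lerDl ltW.
have hy : (y <= x + y)%R by rewrite lerDr ltW.
have := lerD (h x x0 hx) (h y y0 hy).
by rewrite -!mulrDl divff ?mul1r // gt_eqF.
Qed.

Lemma poweR_series_le (p : R) g : (0 < p)%R -> (p <= 1)%R ->
  (forall k, 0 <= g k) ->
  (\sum_(0 <= k <oo) g k) `^ p <= \sum_(0 <= k <oo) (g k `^ p).
Proof.
move=> p0 p1 g0.
have gp0 k : 0 <= g k `^ p by exact: poweR_ge0.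
set T := (X in _ <= X).
have T0 : 0 <= T by exact: nneseries_ge0.
have fin N : (\sum_(0 <= k < N) g k) `^ p <= \sum_(0 <= k < N) (g k `^ p).
  elim: N => [|N IH]; first by rewrite !big_nil poweR0r // gt_eqF.
  rewrite !big_nat_recr //=; apply: (le_trans (poweR_leD p0 p1 _ (g0 N))).
    exact: sume_ge0.
  exact: leeD.
have le1 : \sum_(0 <= k <oo) g k <= T `^ p^-1.
  apply: lime_le; first exact: is_cvg_nneseries.
  apply: nearW => N.
  have s0 : 0 <= \sum_(0 <= k < N) g k by exact: sume_ge0.
  rewrite -[leLHS]poweRe1 // -(mulfV (lt0r_neq0 p0)) poweRrM.
  apply: gt0_ler_poweR; rewrite ?in_itv /= ?leey ?andbT ?poweR_ge0 ?invr_ge0 ?(ltW p0) //.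
  by apply: (le_trans (fin N)); exact: nneseries_lim_ge.
rewrite -[leRHS]poweRe1 // -(mulVf (lt0r_neq0 p0)) poweRrM.
apply: gt0_ler_poweR; rewrite ?in_itv /= ?leey ?andbT ?poweR_ge0 ?(ltW p0) //.
exact: nneseries_ge0.
Qed.

(** The tangent line at tau to the convex function x^p, solved for x.  Being linear
    in x^p, it can be summed over a whole series at once. *)
Lemma poweR_young (p tau : R) (x : \bar R) : (1 < p)%R -> (0 < tau)%R -> 0 <= x ->
  x <= (p^-1 * tau `^ (1 - p))%:E * x `^ p + ((1 - p^-1) * tau)%:E.
Proof.
move=> p1 t0; have p0 : (0 < p)%R by lra.
have k0 : (0 < p^-1 * tau `^ (1 - p))%R by rewrite mulr_gt0 ?powR_gt0 ?invr_gt0.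
case: x => [x| |] // x0; last by rewrite poweRyr ?gt_eqF // gt0_muley.
move: x0; rewrite poweR_EFin -EFinM -EFinD !lee_fin => x0.
have u0 : (0 <= x / tau)%R by rewrite divr_ge0 // ltW.
have E1 : ((x / tau) `^ p = x `^ p * tau `^ (- p))%R.
  rewrite powRM ?invr_ge0 ?(ltW t0) //; congr (_ * _)%R.
  by rewrite -[(tau^-1)%R]powR_inv1 ?(ltW t0) // -powRrM mulN1r.
have E2 : (tau `^ (1 - p) = tau * tau `^ (- p))%R.
  by rewrite powRD ?(gt_eqF t0) ?implybT // powRr1 // ltW.
have := le_powR_young p1 u0; rewrite ler_pdivrMr // mulrDl E1 E2 => /le_trans; apply.
by rewrite le_eqVlt; apply/orP; left; apply/eqP; ring.
Qed.

(** Jensen's inequality for the weights c k, of total mass S. *)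
Lemma poweR_weighted_series_le (p : R) c g (S : R) : (1 < p)%R ->
  (forall k, 0 <= c k)%R -> (forall k, 0 <= g k) ->
  \sum_(0 <= k <oo) (c k)%:E = S%:E ->
  (\sum_(0 <= k <oo) (c k)%:E * g k) `^ p <=
    (S `^ (p - 1))%:E * \sum_(0 <= k <oo) (c k)%:E * g k `^ p.
Proof.
move=> p1 c0 g0 cS; have p0 : (0 < p)%R by lra.
have pn : p != 0%R by rewrite gt_eqF.
have cE0 k : 0 <= (c k)%:E by rewrite lee_fin.
have cg0 k : 0 <= (c k)%:E * g k by rewrite mule_ge0.
have cgp0 k : 0 <= (c k)%:E * g k `^ p by rewrite mule_ge0 ?poweR_ge0.
have S0 : (0 <= S)%R by rewrite -lee_fin -cS; exact: nneseries_ge0.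
set X := (X in _ * X).
have X0 : 0 <= X by exact: nneseries_ge0.
set Y := \sum_(0 <= k <oo) _.
have Y0 : 0 <= Y by exact: nneseries_ge0.
have cS' k : (c k <= S)%R by rewrite -lee_fin -cS; exact: (nneseries_ge_term (u := EFin \o c)).
move: S0; rewrite le_eqVlt => /orP[/eqP S00|S0].
  have -> : Y = 0.
    apply: eseries0 => k _ _; have := cS' k; rewrite -S00 => ck.
    by rewrite (_ : c k = 0%R) ?mul0e //; apply/eqP; rewrite eq_le ck c0.
  by rewrite poweR0r // mule_ge0 // lee_fin powR_ge0.
have young tau : (0 < tau)%R ->
    Y <= (p^-1 * tau `^ (1 - p))%:E * X + ((1 - p^-1) * tau * S)%:E.
  move=> t0; have k0 : (0 <= p^-1 * tau `^ (1 - p))%R.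
    by rewrite mulr_ge0 ?powR_ge0 ?invr_ge0 ?ltW.
  have k1 : (0 <= (1 - p^-1) * tau)%R.
    by rewrite mulr_ge0 ?(ltW t0) // subr_ge0 invf_le1 // ltW.
  rewrite [((1 - p^-1) * tau * S)%:E]EFinM -cS /X -!nneseriesZl // -nneseriesD; last 2 first.
  - by move=> k _ _; rewrite mule_ge0 // lee_fin.
  - by move=> k _ _; rewrite mule_ge0 // lee_fin.
  apply: lee_nneseries => k _ //.
  apply: (le_trans (lee_wpmul2l (cE0 k) (poweR_young p1 t0 (g0 k)))).
  rewrite ge0_muleDr ?mule_ge0 ?poweR_ge0 ?lee_fin //.
  by rewrite muleCA [X in _ + X]muleC.
case: X X0 young => [X| |] // X0 young; last first.
  by rewrite gt0_muley ?leey // lte_fin powR_gt0.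
move: X0; rewrite lee_fin le_eqVlt => /orP[/eqP X00|X0].
  have -> : Y = 0.
    apply/eqP; rewrite eq_le Y0 andbT; apply/lee_addgt0Pr => e e0; rewrite add0e.
    have t0 : (0 < e / S)%R by rewrite divr_gt0.
    apply: (le_trans (young _ t0)); rewrite -X00 mule0 add0e lee_fin.
    rewrite -mulrA divfK ?gt_eqF // ler_piMl ?(ltW e0) //.
    by rewrite gerBl invr_ge0 ltW.
  by rewrite poweR0r // -X00 mule0.
(* The value of tau that minimizes the bound given by young. *)
pose tau := ((X / S) `^ p^-1)%R.
have XS : (0 < X / S)%R by rewrite divr_gt0.
have t0 : (0 < tau)%R by rewrite powR_gt0.
have taup : (tau `^ p = X / S)%R by rewrite /tau -powRrM mulVf // powRr1 // ltW.
have YS : Y <= (S * tau)%:E.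
  apply: (le_trans (young _ t0)); rewrite -EFinM -EFinD lee_fin.
  rewrite powRB ?(gt_eqF t0) ?implybT // powRr1 ?(ltW t0) // taup.
  rewrite le_eqVlt; apply/orP; left; apply/eqP.
  by field; rewrite pn !gt_eqF.
apply: (@le_trans _ _ ((S * tau)%:E `^ p)).
  apply: gt0_ler_poweR; rewrite ?in_itv /= ?leey ?andbT ?(ltW p0) //.
  by rewrite lee_fin mulr_ge0 ?ltW.
rewrite poweR_EFin -EFinM lee_fin powRM ?(ltW S0) ?(ltW t0) // taup.
rewrite powRB ?(gt_eqF S0) ?implybT // powRr1 ?(ltW S0) //.
by rewrite le_eqVlt; apply/orP; left; apply/eqP; field; rewrite gt_eqF.
Qed.

End power_of_series.

(** * Sums of blocks *)
Section block_series.
Context {R : realType} {n : nat}.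
Local Notation mu := (@lebesgueN R n).
Implicit Types (x y : n.-tuple R).
Import ComplexField.Normc.

Lemma pbar_gt0 (p : R) : 0 < p -> 0 < pbar p.
Proof. by move=> p0; rewrite /pbar lt_min p0 ltr01. Qed.

(** The exponent p / pbar - 1 is 0 for p <= 1 and p - 1 for p > 1, so that one
    formula covers subadditivity and convexity. *)
Lemma poweR_pbar_series_le (p S : R) (c : nat -> R) (g : nat -> \bar R) : 0 < p ->
  (forall k, 0 <= c k) -> (forall k, 0 <= g k)%E ->
  (\sum_(0 <= k <oo) (c k `^ pbar p)%:E = S%:E)%E ->
  ((\sum_(0 <= k <oo) (c k)%:E * g k) `^ p <=
    (S `^ (p / pbar p - 1))%:E *
    \sum_(0 <= k <oo) (c k `^ pbar p)%:E * g k `^ p)%E.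
Proof.
move=> p0 c0 g0; rewrite /pbar; case: (leP p 1) => p1 cS.
  rewrite divff ?gt_eqF // subrr powRr0 mul1e.
  have cg0 k : (0 <= (c k)%:E * g k)%E by rewrite mule_ge0 // lee_fin.
  apply: (le_trans (poweR_series_le p0 p1 cg0)).
  apply: lee_nneseries => k _; first by move=> _; exact: poweR_ge0.
  by rewrite poweRM ?lee_fin.
rewrite divr1.
have E k : c k `^ 1 = c k by rewrite powRr1.
move: cS; under eq_eseriesr do rewrite E.
move=> cS; under [in leRHS]eq_eseriesr do rewrite E.
exact: poweR_weighted_series_le.
Qed.

Lemma weighted_series_integral_le (p alpha S C : R) (c : nat -> R)
    (G : nat -> n.-tuple R -> \bar R) : 0 < p -> 0 <= C ->
  (forall k, 0 <= c k) -> (forall k x, 0 <= G k x)%E ->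
  (forall k, measurable_fun setT (G k)) ->
  (forall k, (\int[mu]_x (G k x `^ p * (enorm x `^ alpha)%:E) <= C%:E)%E) ->
  (\sum_(0 <= k <oo) (c k `^ pbar p)%:E = S%:E)%E ->
  (\int[mu]_x ((\sum_(0 <= k <oo) (c k)%:E * G k x) `^ p * (enorm x `^ alpha)%:E)
    <= (S `^ (p / pbar p) * C)%:E)%E.
Proof.
move=> p0 C0 c0 G0 mG GC cS.
have pb0 := pbar_gt0 p0.
have pbp : pbar p <= p by rewrite /pbar ge_min lexx.
pose q := p / pbar p.
have q1 : 1 <= q by rewrite ler_pdivlMr // mul1r.
have S0 : 0 <= S.
  by rewrite -lee_fin -cS; apply: nneseries_ge0 => k _ _; rewrite lee_fin powR_ge0.
have SE : S * S `^ (q - 1) = S `^ q by rewrite mulr_powRB1 // (lt_le_trans ltr01).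
pose w x : \bar R := (enorm x `^ alpha)%:E.
have w0 x : (0 <= w x)%E by rewrite lee_fin powR_ge0.
have mw : measurable_fun setT w by apply/measurable_EFinP; exact: measurable_weight.
have cp0 k : 0 <= c k `^ pbar p by exact: powR_ge0.
have Gpw0 k x : (0 <= G k x `^ p * w x)%E by exact: mule_ge0 (poweR_ge0 _ _) (w0 x).
have mGpw k : measurable_fun setT (fun x => G k x `^ p * w x)%E.
  apply: emeasurable_funM => //.
  exact: (measurableT_comp (measurable_poweR p)).
apply: (@le_trans _ _ (\int[mu]_x (\sum_(0 <= k <oo)
    (S `^ (q - 1) * c k `^ pbar p)%:E * (G k x `^ p * w x)))%E).
  apply: le_integral_nonmeasurable => x _; first by exact: mule_ge0 (poweR_ge0 _ _) (w0 x).
  have := poweR_pbar_series_le p0 c0 (fun k => G0 k x) cS.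
  move=> /(lee_wpmul2r (w0 x)) /le_trans; apply.
  have cG0 k : (0 <= (c k `^ pbar p)%:E * G k x `^ p)%E.
    by apply: mule_ge0; [rewrite lee_fin|exact: poweR_ge0].
  rewrite -/q -muleA [X in (_ * X)%E]muleC /w -nneseriesZl // -/(w x).
  rewrite -nneseriesZl; last by move=> k _; exact: mule_ge0 (w0 x) (cG0 k).
  apply: lee_nneseries => k _.
    move=> _; apply: mule_ge0; first by rewrite lee_fin powR_ge0.
    exact: mule_ge0 (w0 x) (cG0 k).
  by rewrite EFinM [(w x * _)%E]muleC !muleA.
rewrite integral_nneseries //; last 2 first.
- by move=> k; apply: emeasurable_funM.
- by move=> k x _; apply: mule_ge0 => //; rewrite lee_fin; exact: mulr_ge0 (powR_ge0 _ _) _.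
apply: (@le_trans _ _ (\sum_(0 <= k <oo) (S `^ (q - 1) * C)%:E * (c k `^ pbar p)%:E)%E).
  apply: lee_nneseries => k _.
    move=> _; apply: integral_ge0 => x _; apply: mule_ge0 => //.
    by rewrite lee_fin; exact: mulr_ge0 (powR_ge0 _ _) _.
  have sc0 : (0 <= (S `^ (q - 1) * c k `^ pbar p)%:E)%E.
    by rewrite lee_fin; exact: mulr_ge0 (powR_ge0 _ _) _.
  rewrite ge0_integralZl //.
  apply: (le_trans (lee_wpmul2l sc0 (GC k))).
  by rewrite -!EFinM lee_fin le_eqVlt; apply/orP; left; apply/eqP; ring.
rewrite nneseriesZl; last by move=> k _; rewrite lee_fin.
rewrite cS -EFinM lee_fin -/q -SE.
by rewrite le_eqVlt; apply/orP; left; apply/eqP; ring.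
Qed.

(** This transfers the convergence of a block decomposition at a point to a
    domination by a series of nonnegative Borel functions. *)
Lemma normc_le_series (c : nat -> R[i]) (a : nat -> R[i]) (f : R[i]) :
  (fun N => normc (\sum_(k < N) c k * a k - f)) @ \oo --> (0 : R) ->
  ((normc f)%:E <= \sum_(0 <= k <oo) (normc (c k))%:E * (normc (a k))%:E)%E.
Proof.
move=> cv; set T := (X in (_ <= X)%E).
have t0 k : (0 <= (normc (c k))%:E * (normc (a k))%:E)%E.
  by rewrite mule_ge0 // lee_fin normc_ge0.
have partial N : ((normc (\sum_(k < N) c k * a k)%R)%:E <= T)%E.
  apply: (@le_trans _ _ (\sum_(0 <= k < N) (normc (c k))%:E * (normc (a k))%:E)%E); last first.
    exact: nneseries_lim_ge.
  elim: N => [|N IH]; first by rewrite big_ord0 normc0 big_nil.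
  rewrite big_ord_recr big_nat_recr //=; apply: le_trans (leeD IH (lexx _)).
  by rewrite -EFinM -EFinD lee_fin -normcM; exact: le_normcD.
apply/lee_addgt0Pr => e e0.
have /cvgrPdist_lt /(_ e e0) [N _ /(_ N (leqnn N))] := cv.
rewrite sub0r normrN ger0_norm ?normc_ge0 // => h.
apply: (@le_trans _ _ ((normc (\sum_(k < N) c k * a k)%R)%:E + e%:E)%E); last exact: leeD.
rewrite -EFinD lee_fin -[f](subKr (\sum_(k < N) c k * a k)).
apply: (le_trans (le_normcD _ _)); rewrite normcN lerD //; exact: ltW.
Qed.

End block_series.

Theorem theorem5p6 (R : realType) (n : nat) (lambda s p alpha : R)
    (n_gt0 : (0 < n)%N)
    (lambda_gt : (n%:R - 1) / 2 < lambda)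
    (s_gt1 : 1 < s)
    (p_gt0 : 0 < p) (p_lts : p < s)
    (alpha_gt : n%:R * (p / s - 1) < alpha)
    (alpha_lt : alpha < n%:R * (p - 1))
    (alpha_le0 : alpha <= 0) :
  exists C : R, forall f : n.-tuple R -> R[i],
    BL p s%:E alpha f ->
    (wLnorm p alpha (max_bochner_riesz lambda f) <=
     C%:E * BLnorm p s%:E alpha f)%E.
Proof.
have [C1 C10 H1] := max_bochner_riesz_le_maximal n_gt0 lambda_gt.
have [C2 C20 H2] := block_maximal_le n_gt0 s_gt1 p_gt0 alpha_gt alpha_lt alpha_le0.
pose C := C1 * C2 `^ p^-1.
have C0 : 0 < C by rewrite mulr_gt0 ?powR_gt0.
exists C => f _.
suff H v : [set ((coeff_sum_pbar p c) `^ (pbar p)^-1)%E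
            | c in [set c | exists a : nat -> n.-tuple R -> R[i],
                        block_decomposition p s%:E alpha f c a]] v ->
    (wLnorm p alpha (max_bochner_riesz lambda f) <= C%:E * v)%E.
  rewrite -lee_pdivrMl //; apply: le_ereal_inf_tmp => v /H.
  by rewrite lee_pdivrMl.
move=> [c [a [blk cfin cv]] <-].
pose nc k := ComplexField.Normc.normc (c k).
pose na k y := ComplexField.Normc.normc (a k y).
have nc0 k : 0 <= nc k by exact: normc_ge0.
have na0 k y : (0 <= (na k y)%:E)%E by rewrite lee_fin; exact: normc_ge0.
have mna k : measurable_fun setT (fun y => (na k y)%:E).
  by apply/measurable_EFinP; have [? ? _] := blk k; exact: measurable_normc.
have ncna0 k y : (0 <= (nc k)%:E * (na k y)%:E)%E.
  by apply: mule_ge0 => //; rewrite lee_fin.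
pose F y : \bar R := (\sum_(0 <= k <oo) (nc k)%:E * (na k y)%:E)%E.
have F0 y : (0 <= F y)%E by exact: nneseries_ge0.
have mF : measurable_fun setT F.
  by apply: ge0_emeasurable_sum => // k _; exact: emeasurable_funM.
pose G k := HL_maximal (fun y => (na k y)%:E).
have G0 k x : (0 <= G k x)%E by exact: HL_maximal_ge0.
have mG k : measurable_fun setT (G k) by exact: measurable_HL_maximal.
have BG x : (max_bochner_riesz lambda f x <=
    C1%:E * \sum_(0 <= k <oo) (nc k)%:E * G k x)%E.
  apply: (@le_trans _ _ (C1%:E * HL_maximal F x)%E).
    apply: H1 => //; apply: filterS cv => y; exact: normc_le_series.
  apply: lee_wpmul2l; first by rewrite lee_fin ltW.
  exact: HL_maximal_series.
have S0 : (0 <= coeff_sum_pbar p c)%E.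
  by apply: nneseries_ge0 => k _ _; rewrite lee_fin powR_ge0.
pose S := fine (coeff_sum_pbar p c).
have SE : coeff_sum_pbar p c = S%:E by rewrite fineK // ge0_fin_numE.
have SR0 : 0 <= S by rewrite -lee_fin -SE.
have I := weighted_series_integral_le p_gt0 (ltW C20) nc0 G0 mG
  (fun k => H2 _ (blk k)) SE.
pose I0 := (\int[lebesgueN n]_x
  ((\sum_(0 <= k <oo) (nc k)%:E * G k x) `^ p * (enorm x `^ alpha)%:E))%E.
have pn : p != 0 by rewrite gt_eqF.
have sum0 x : (0 <= \sum_(0 <= k <oo) (nc k)%:E * G k x)%E.
  by apply: nneseries_ge0 => k _ _; apply: mule_ge0; rewrite ?lee_fin.
have w0 (x : n.-tuple R) : (0 <= (enorm x `^ alpha)%:E)%E by rewrite lee_fin powR_ge0.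
have C1p : 0 <= C1 `^ p by exact: powR_ge0.
have J : (\int[lebesgueN n]_x (`|max_bochner_riesz lambda f x| `^ p * (enorm x `^ alpha)%:E)
   <= (C1 `^ p * (S `^ (p / pbar p) * C2))%:E)%E.
  apply: (@le_trans _ _ (\int[lebesgueN n]_x ((C1 `^ p)%:E *
      ((\sum_(0 <= k <oo) (nc k)%:E * G k x) `^ p * (enorm x `^ alpha)%:E)))%E).
    apply: le_integral_nonmeasurable => x _.
      exact: mule_ge0 (poweR_ge0 _ _) (w0 x).
    rewrite muleA; apply: lee_wpmul2r => //.
    rewrite -poweR_EFin -poweRM ?lee_fin ?(ltW C10) //.
    rewrite gee0_abs ?max_bochner_riesz_ge0 //.
    apply: gt0_ler_poweR; rewrite ?in_itv /= ?leey ?andbT ?(ltW p_gt0) //.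
      exact: max_bochner_riesz_ge0.
    by apply: mule_ge0 => //; rewrite lee_fin ltW.
  rewrite ge0_integralZl ?lee_fin //; last 2 first.
  - apply: emeasurable_funM; last by apply/measurable_EFinP; exact: measurable_weight.
    apply: (measurableT_comp (measurable_poweR p)).
    apply: ge0_emeasurable_sum => [k x _ _|k _].
      by apply: mule_ge0; rewrite ?lee_fin.
    exact: emeasurable_funM.
  - by move=> x _; exact: mule_ge0 (poweR_ge0 _ _) (w0 x).
  by rewrite EFinM; apply: lee_wpmul2l; rewrite ?lee_fin.
rewrite /wLnorm SE poweR_EFin -EFinM.
have := gt0_ler_poweR (r := p^-1) _ _ _ J.
rewrite !in_itv /= !leey !andbT invr_ge0 (ltW p_gt0) lee_fin.
rewrite (integral_ge0 _ (fun x _ => mule_ge0 (poweR_ge0 _ _) (w0 x))).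
have R0 : 0 <= C1 `^ p * (S `^ (p / pbar p) * C2).
  by apply: mulr_ge0 => //; apply: mulr_ge0; [exact: powR_ge0|exact: ltW].
rewrite R0 => /(_ isT isT isT) /le_trans; apply.
rewrite lee_fin powRM //; last by apply: mulr_ge0; [exact: powR_ge0|exact: ltW].
rewrite powRM ?powR_ge0 ?(ltW C20) // -!powRrM mulfV // powRr1 ?(ltW C10) //.
have -> : p / pbar p / p = (pbar p)^-1.
  by field; rewrite pn gt_eqF ?pbar_gt0.
by rewrite /C le_eqVlt; apply/orP; left; apply/eqP; ring.
Qed.
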